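(* Let $r\geq 0$. Every filtered dg-algebra has an $E_r$-minimal $A_\infty$-model.
   Context: Work over a field. A filtered dg-algebra $(A,d,\mu,F)$ is a dg-algebra with a decreasing, bounded below, exhaustive filtration $F$ with $d(F^pA^n)\subseteq F^pA^{n+1}$ and $\mu(F^pA\otimes F^qA)\subseteq F^{p+q}A$; $E_r(A)$ denotes the $r$-th page of its associated spectral sequence. An $E_r$-minimal $A_\infty$-model of $(A,d,F)$ is an $A_\infty$-algebra $(M,d,\nu_s)$ with a bigrading $M=\bigoplus M^{p,q}$ (with $M^n=\bigoplus_{p+q=n}M^{p,q}$, filtered by $F^pM^n=\bigoplus_{p'\ge p}M^{p',n-p'}$) such that $d(M^{p,q})\subseteq \bigoplus_{k\geq 0}M^{p+r+k+1,q-r-k}$ and, for all $s\geq 2$, $\nu_s(M^{p_1,q_1}\otimes\cdots\otimes M^{p_s,q_s})\subseteq \bigoplus_{k\geq 0}M^{p_1+\cdots+p_s+(2-s)r+k,\;q_1+\cdots+q_s+(2-s)(1-r)-k}$, together with a morphism of $A_\infty$-algebras $f=(f_s)_{s\ge1}:M\to A$ (where $A$ is viewed as an $A_\infty$-algebra with $\nu_2=\mu$, $\nu_s=0$ for $s\ge 3$) satisfying $f_s(M^{p_1,q_1}\otimes\cdots\otimes M^{p_s,q_s})\subseteq F^{p_1+\cdots+p_s+(1-s)r}A^{p_1+\cdots+p_s+q_1+\cdots+q_s-s+1}$ and such that $E_r(f_1):E_{r}(M)\to E_{r}(A)$ is a quasi-isomorphism of complexes. *)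

(* Defs.v *)
From HB Require Import structures.
From mathcomp Require Import all_boot all_order all_algebra.
Set Implicit Arguments. Unset Strict Implicit. Unset Printing Implicit Defensive.
Import Order.TTheory GRing.Theory Num.Theory.
Local Open Scope ring_scope.

Section Defs.
Variable K : fieldType.

Definition kozn (k : nat) : K := (-1) ^+ k.
Definition koz (z : int) : K := (-1) ^+ `|z|%N.
Definition sumz (l : seq int) : int := \sum_(d <- l) d.

Section OneSpace.
Variable V : lmodType K.

Definition subspace (S : V -> Prop) :=
  S 0 /\ forall (a : K) x y, S x -> S y -> S (a *: x + y).

Definition sum_of (I : eqType) (P : I -> Prop) (D : I -> V -> Prop) (v : V) :=
  exists (s : seq I) (g : I -> V),
    (forall i, i \in s -> P i) /\ (forall i, D i (g i)) /\ v = \sum_(i <- s) g i.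

Definition dsum (I : eqType) (D : I -> V -> Prop) :=
  (forall i, subspace (D i)) /\
  (forall v, sum_of (fun _ => True) D v) /\
  (forall (s : seq I) (g : I -> V), uniq s -> (forall i, D i (g i)) ->
     \sum_(i <- s) g i = 0 -> forall i, i \in s -> g i = 0).

Definition homog (I : Type) (i0 : I) (D : I -> V -> Prop) (xs : seq V) (ds : seq I) :=
  size xs = size ds /\ forall i, (i < size xs)%N -> D (nth i0 ds i) (nth 0 xs i).

(* multilinear maps V^{(x) s} -> W, encoded on lists (arity = length) *)
Definition multilinear (W : lmodType K) (m : seq V -> W) :=
  forall (l1 l2 : seq V) (a : K) (x y : V),
    m (l1 ++ (a *: x + y) :: l2) = a *: m (l1 ++ x :: l2) + m (l1 ++ y :: l2).

Definition linearP (W : lmodType K) (h : V -> W) :=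
  forall (a : K) x y, h (a *: x + y) = a *: h x + h y.

Definition bilinearP (W : lmodType K) (mu : V -> V -> W) :=
  (forall y, linearP (fun x => mu x y)) /\ (forall x, linearP (mu x)).

(* sum_{r+s+t=n, s>=1} (-1)^{r+st} g(1^r (x) m_s (x) 1^t)(x_1,...,x_n),
   with the Koszul sign (-1)^{s(|x_1|+...+|x_r|)} (|m_s| = 2-s). *)
Definition ins_sum (W : lmodType K) (g : seq V -> W) (m : seq V -> V)
    (xs : seq V) (ds : seq int) : W :=
  let n := size xs in
  \sum_(r < n.+1) \sum_(s < n.+1 | (0 < s)%N && (r + s <= n)%N)
     (kozn (r + s * (n - r - s)) * koz (s%:Z * sumz (take r ds)))
       *: g (take r xs ++ m (take s (drop r xs)) :: drop (r + s) xs).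

(* A-infinity algebra (V, m_s), m_1 = m [:: x] the differential, on the graded
   space V = (+)_n deg n; m_s of degree 2 - s; Stasheff identities. *)
Definition is_Ainf (deg : int -> V -> Prop) (m : seq V -> V) :=
  dsum deg /\ multilinear m /\
  (forall xs ds, homog 0 deg xs ds -> (0 < size xs)%N ->
     deg (sumz ds + 2 - (size xs)%:Z) (m xs)) /\
  (forall xs ds, homog 0 deg xs ds -> (0 < size xs)%N -> ins_sum m m xs ds = 0).

Definition is_dga (deg : int -> V -> Prop) (d : V -> V) (mu : V -> V -> V) :=
  dsum deg /\ linearP d /\
  (forall n x, deg n x -> deg (n + 1) (d x)) /\
  (forall x, d (d x) = 0) /\
  bilinearP mu /\
  (forall n k x y, deg n x -> deg k y -> deg (n + k) (mu x y)) /\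
  (forall x y z, mu (mu x y) z = mu x (mu y z)) /\
  (forall n x y, deg n x -> d (mu x y) = mu (d x) y + koz n *: mu x (d y)).

(* filtered dg-algebra; F p n is F^p A^n *)
Definition is_filtered_dga (deg : int -> V -> Prop) (F : int -> int -> V -> Prop)
    (d : V -> V) (mu : V -> V -> V) :=
  is_dga deg d mu /\
  (forall p n, subspace (F p n)) /\
  (forall p n x, F p n x -> deg n x) /\
  (forall p n x, F (p + 1) n x -> F p n x) /\
  (forall p n x, F p n x -> F p (n + 1) (d x)) /\
  (forall p q n k x y, F p n x -> F q k y -> F (p + q) (n + k) (mu x y)) /\
  (forall n x, deg n x -> exists p, F p n x) /\
  (forall n, exists p, forall x, F p n x -> x = 0).

(* Spectral sequence of a filtered complex (V, d, F):
   Z_r^{p,n} = F^pV^n /\ d^{-1}(F^{p+r}V^{n+1}),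
   E_r^{p,n} = Z_r^{p,n} / (Z_{r-1}^{p+1,n} + d Z_{r-1}^{p-r+1,n-1}),
   d_r : E_r^{p,n} -> E_r^{p+r,n+1} induced by d. *)
Definition Zr (F : int -> int -> V -> Prop) (d : V -> V) (r p n : int) (x : V) :=
  F p n x /\ F (p + r) (n + 1) (d x).

(* denominator of E_r^{p,n} *)
Definition Br (F : int -> int -> V -> Prop) (d : V -> V) (r p n : int) (x : V) :=
  exists y z, Zr F d (r - 1) (p + 1) n y /\ Zr F d (r - 1) (p - r + 1) (n - 1) z /\
              x = y + d z.

(* x in Z_r^{p,n} represents a d_r-cocycle of E_r^{p,n} *)
Definition Er_cycle (F : int -> int -> V -> Prop) (d : V -> V) (r p n : int) (x : V) :=
  Zr F d r p n x /\ Br F d r (p + r) (n + 1) (d x).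

(* the class of x in E_r^{p,n} is a d_r-coboundary *)
Definition Er_bdry (F : int -> int -> V -> Prop) (d : V -> V) (r p n : int) (x : V) :=
  exists y, Zr F d r (p - r) (n - 1) y /\ Br F d r p n (x - d y).

End OneSpace.

(* E_r(f) : E_r(M) -> E_r(A) is a quasi-isomorphism of complexes (E_r, d_r):
   the induced map on H^{p,n}(E_r, d_r) is injective and surjective for all p,n *)
Definition Er_quasi_iso (M A : lmodType K)
    (FM : int -> int -> M -> Prop) (dM : M -> M)
    (FA : int -> int -> A -> Prop) (dA : A -> A) (f : M -> A) (r : int) :=
  forall p n,
    (forall x, Er_cycle FM dM r p n x -> Er_bdry FA dA r p n (f x) ->
               Er_bdry FM dM r p n x) /\
    (forall a, Er_cycle FA dA r p n a ->
               exists x, Er_cycle FM dM r p n x /\ Er_bdry FA dA r p n (a - f x)).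

(* A-infinity morphism f = (f_s) from (M, nu) to the dga (A, dA, mu) viewed as an
   A-infinity algebra (m_1 = dA, m_2 = mu, m_s = 0 for s >= 3); the general equation
   sum (-1)^{r+st} f(1^r (x) nu_s (x) 1^t) = sum (-1)^w m_q (f_{i_1} (x) ... (x) f_{i_q})
   with w = sum_j (q-j)(i_j - 1), only the terms q = 1, 2 survive. *)
Definition is_Ainf_morph_to_dga (M A : lmodType K)
    (degM : int -> M -> Prop) (nu : seq M -> M)
    (degA : int -> A -> Prop) (dA : A -> A) (mu : A -> A -> A) (f : seq M -> A) :=
  multilinear f /\
  (forall xs ds, homog 0 degM xs ds -> (0 < size xs)%N ->
     degA (sumz ds + 1 - (size xs)%:Z) (f xs)) /\
  (forall xs ds, homog 0 degM xs ds -> (0 < size xs)%N ->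
     ins_sum f nu xs ds =
       dA (f xs) +
       \sum_(1 <= i < size xs)
          (kozn (i - 1) * koz ((1 - (size xs - i)%:Z) * sumz (take i ds)))
            *: mu (f (take i xs)) (f (drop i xs))).

Definition bideg (M : lmodType K) (Mb : int -> int -> M -> Prop) (n : int) (x : M) :=
  sum_of (fun pq : int * int => pq.1 + pq.2 = n) (fun pq => Mb pq.1 pq.2) x.

Definition bifilt (M : lmodType K) (Mb : int -> int -> M -> Prop) (p n : int) (x : M) :=
  sum_of (fun pq : int * int => pq.1 + pq.2 = n /\ p <= pq.1)
         (fun pq => Mb pq.1 pq.2) x.

Definition Er_minimal_model (r : nat) (A : lmodType K)
    (degA : int -> A -> Prop) (FA : int -> int -> A -> Prop)
    (dA : A -> A) (mu : A -> A -> A)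
    (M : lmodType K) (Mb : int -> int -> M -> Prop) (nu : seq M -> M)
    (f : seq M -> A) :=
  let R := r%:Z in
  dsum (fun pq : int * int => Mb pq.1 pq.2) /\
  is_Ainf (bideg Mb) nu /\
  (forall p q x, Mb p q x ->
     sum_of (fun pq : int * int => exists k : int, 0 <= k /\
               pq = (p + R + k + 1, q - R - k))
            (fun pq => Mb pq.1 pq.2) (nu [:: x])) /\
  (forall xs pqs, homog (0, 0) (fun pq : int * int => Mb pq.1 pq.2) xs pqs ->
     (2 <= size xs)%N ->
     let s := (size xs)%:Z in
     let P := sumz (map fst pqs) in
     let Q := sumz (map snd pqs) in
     sum_of (fun pq : int * int => exists k : int, 0 <= k /\
               pq = (P + (2 - s) * R + k, Q + (2 - s) * (1 - R) - k))
            (fun pq => Mb pq.1 pq.2) (nu xs)) /\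
  is_Ainf_morph_to_dga (bideg Mb) nu degA dA mu f /\
  (forall xs pqs, homog (0, 0) (fun pq : int * int => Mb pq.1 pq.2) xs pqs ->
     (1 <= size xs)%N ->
     let s := (size xs)%:Z in
     let P := sumz (map fst pqs) in
     let Q := sumz (map snd pqs) in
     FA (P + (1 - s) * R) (P + Q - s + 1) (f xs)) /\
  Er_quasi_iso (bifilt Mb) (fun x => nu [:: x]) FA dA (fun x => f [:: x]) R.

End Defs.

(* Main.v *)
(** Replacing [F] by the filtration [G^p A^n = Z_r^(p + r n)] of elements
    [x] of [F^(p + r n) A^n] with [d x] in [F^(p + r n + r)] turns [A] into a
    filtered dg-algebra for which the case [r = 0] is needed: all shifts by
    multiples of [r] in the definition of a minimal model are absorbed by the
    regrading [p |-> p + r n].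

    Over a field, complements of the [d_0]-cocycles in the associated graded
    give a filtered homotopy [h] of degree [-1] with [h h = 0], [h d h = h] and
    [d h d = d] modulo higher filtration.  The model is the subcomplex
    [M = { x | h x = 0, h d x = 0 }], the image of the projection
    [rho = 1 - d h - h d]; on it [d] raises the filtration.

    The higher operations come from homotopy transfer.  In the bar
    construction no signs remain except the parity operator [t]: with
    [L = sum b (F u) (F v)] over deconcatenations, [F = single - h L] and
    [B = d single + rho L] satisfy [F B = d F + L] and [B B = 0], because
    inserting [B] into [L] gives [- d L].  Desuspending yields [nu] and [f]. *)

From Pilot Require Import Defs.
From HB Require Import structures.
From mathcomp Require Import all_boot all_order all_algebra.
From mathcomp Require Import zify ring boolp classical_sets.
Set Implicit Arguments. Unset Strict Implicit. Unset Printing Implicit Defensive.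
Import Order.TTheory GRing.Theory Num.Theory.
(* [GRing.Theory] also exports a [linearP], so [Defs] is imported again. *)
Import Pilot.Defs.
Local Open Scope ring_scope.

(** * Elementary properties of linear maps *)

Section LinearMaps.
Variables (K : fieldType) (V W : lmodType K) (h : V -> W).
Hypothesis hL : linearP h.

Lemma lmap0 : h 0 = 0.
Proof. by have := hL (-1) 0 0; rewrite scaler0 addr0 scaleN1r addNr. Qed.

Lemma lmapD x y : h (x + y) = h x + h y.
Proof. by rewrite -[x]scale1r hL !scale1r. Qed.

Lemma lmapZ a x : h (a *: x) = a *: h x.
Proof. by rewrite -[a *: x]addr0 hL lmap0 addr0. Qed.

Lemma lmapN x : h (- x) = - h x.
Proof. by rewrite -scaleN1r lmapZ scaleN1r. Qed.

Lemma lmapB x y : h (x - y) = h x - h y.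
Proof. by rewrite lmapD lmapN. Qed.

Lemma lmap_sum (I : Type) (s : seq I) (P : pred I) (g : I -> V) :
  h (\sum_(i <- s | P i) g i) = \sum_(i <- s | P i) h (g i).
Proof. by apply: big_morph; [exact: lmapD | exact: lmap0]. Qed.

End LinearMaps.

(** * Subspaces, complements and projectors over a field *)

Section Subspaces.
Variables (K : fieldType) (V : lmodType K).
Implicit Types (S T : V -> Prop).

Section One.
Variable S : V -> Prop.
Hypothesis hS : subspace S.

Lemma subspace0 : S 0. Proof. by case: hS. Qed.

Lemma subspaceD x y : S x -> S y -> S (x + y).
Proof. by move=> Sx Sy; rewrite -[x]scale1r; apply: hS.2. Qed.

Lemma subspaceZ a x : S x -> S (a *: x).
Proof. by move=> Sx; rewrite -[_ *: _]addr0; apply: hS.2 => //; exact: subspace0. Qed.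

Lemma subspaceN x : S x -> S (- x).
Proof. by move=> Sx; rewrite -scaleN1r; exact: subspaceZ. Qed.

Lemma subspaceB x y : S x -> S y -> S (x - y).
Proof. by move=> Sx Sy; apply: subspaceD => //; exact: subspaceN. Qed.

Lemma subspace_sum (I : eqType) (s : seq I) (g : I -> V) :
  (forall i, i \in s -> S (g i)) -> S (\sum_(i <- s) g i).
Proof.
move=> Sg; rewrite big_seq; apply: (big_ind S) => //.
- exact: subspace0.
- exact: subspaceD.
Qed.

End One.

Lemma subspaceI S T : subspace S -> subspace T -> subspace (fun x => S x /\ T x).
Proof.
move=> hS hT; split; first by split; exact: subspace0.
by move=> a x y [? ?] [? ?]; split; [apply: hS.2 | apply: hT.2].
Qed.

Lemma subspace_add S T : subspace S -> subspace T ->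
  subspace (fun z => exists x y, [/\ S x, T y & z = x + y]).
Proof.
move=> hS hT; split.
  by exists 0, 0; rewrite addr0; split=> //; exact: subspace0.
move=> a _ _ [x [y [Sx Ty ->]]] [x' [y' [Sx' Ty' ->]]].
exists (a *: x + x'), (a *: y + y'); split; [exact: hS.2|exact: hT.2|].
by rewrite scalerDr addrACA.
Qed.

Lemma subspace_preimage (W : lmodType K) (h : V -> W) (T : W -> Prop) :
  linearP h -> subspace T -> subspace (fun x => T (h x)).
Proof.
move=> hL hT; split; first by rewrite (lmap0 hL); case: hT.
by move=> a x y Tx Ty; rewrite hL; exact: hT.2.
Qed.

Lemma subspace_kernel (W : lmodType K) (h : V -> W) :
  linearP h -> subspace (fun x => h x = 0).
Proof.
move=> hL; split; first exact: lmap0.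
by move=> a x y hx hy; rewrite hL hx hy scaler0 addr0.
Qed.

Lemma subspace_image (W : lmodType K) (h : W -> V) (T : W -> Prop) :
  linearP h -> subspace T -> subspace (fun y => exists2 x, T x & y = h x).
Proof.
move=> hL hT; split; first by exists 0; [case: hT|rewrite (lmap0 hL)].
by move=> a _ _ [x Tx ->] [y Ty ->]; exists (a *: x + y); [exact: hT.2|rewrite hL].
Qed.

(** Zorn's lemma gives a maximal [U] that contains [T] and meets [S] only in [0]. A vector outside
    [S + U] could be added to [U] without creating an intersection with [S]. *)
Lemma maximal_complement S T : subspace S -> subspace T ->
    (forall x, S x -> T x -> x = 0) ->
  exists U, [/\ subspace U, forall x, T x -> U x,
    forall x, S x -> U x -> x = 0 &
    forall x, exists s u, [/\ S s, U u & x = s + u]].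
Proof.
move=> hS hT ST0.
(* Zorn's lemma also tests the empty chain, so the empty set must satisfy [P]. Hence containing [T]
   is phrased as stability under translation by [T], and [U 0] is recovered afterwards by comparing
   a maximal [U] with [T]. *)
pose P (U : set V) := [/\ forall a x y, U x -> U y -> U (a *: x + y),
  forall x t, U x -> T t -> U (x + t) & forall x, S x -> U x -> x = 0].
have PT : P T by split=> //; [exact: hT.2|move=> x t; exact: subspaceD].
have [|U [[Ulin UT US] Umax]] := @Zorn_bigcup V P.
  move=> F FP Ftot; split.
  - move=> a x y [X FX Xx] [Y FY Yy]; have [XY|YX] := Ftot _ _ FX FY.
      by exists Y => //; have [Ylin _ _] := FP _ FY; apply: Ylin => //; exact: XY.
    by exists X => //; have [Xlin _ _] := FP _ FX; apply: Xlin => //; exact: YX.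
  - by move=> x t [X FX Xx] Tt; exists X => //; have [_ XT _] := FP _ FX; exact: XT.
  - by move=> x Sx [X FX Xx]; have [_ _ XS] := FP _ FX; exact: XS.
have U0 : U 0.
  apply: contrapT => nU0; apply: (Umax T) => //.
  have Ue x : ~ U x by move=> Ux; apply: nU0; rewrite -(addNr x) -scaleN1r; exact: Ulin.
  by split=> [x /Ue//|/(_ 0 (subspace0 hT))].
have hU : subspace U by split.
exists U; split=> //; first by move=> x Tx; rewrite -[x]add0r; exact: UT.
move=> v; apply: contrapT => nv.
apply: (Umax (fun z => exists u a, U u /\ z = u + a *: v)).
  split; first by move=> x Ux; exists x, 0; rewrite scale0r addr0.
  move=> /(_ v) vU; apply: nv; exists 0, v; rewrite add0r; split=> //.
    exact: subspace0.
  by apply: vU; exists 0, 1; rewrite add0r scale1r.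
split.
- move=> a _ _ [u [b [Uu ->]]] [u' [b' [Uu' ->]]].
  exists (a *: u + u'), (a * b + b'); split; first exact: Ulin.
  by rewrite scalerDr scalerA addrACA -scalerDl.
- move=> _ t [u [b [Uu ->]]] Tt; exists (u + t), b; split; first exact: UT.
  by rewrite addrAC.
- move=> x Sx [u [b [Uu xE]]]; have [b0|b0] := eqVneq b 0.
    by apply: US => //; rewrite xE b0 scale0r addr0.
  exfalso; apply: nv; exists (b^-1 *: x), (- (b^-1 *: u)); split.
  + exact: subspaceZ.
  + by apply: subspaceN => //; exact: subspaceZ.
  + by rewrite xE scalerDr scalerA mulVf // scale1r addrC addKr.
Qed.

(** Project along a complement of [S] chosen to contain [T]. *)
Lemma linear_projector S T : subspace S -> subspace T ->
    (forall x, S x -> T x -> x = 0) ->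
  exists q : V -> V, [/\ linearP q, forall x, S (q x),
    forall x, S x -> q x = x & forall x, T x -> q x = 0].
Proof.
move=> hS hT /(maximal_complement hS hT)[U [hU TU US0 dec]].
have [|q qP] := @choice _ _ (fun x s => S s /\ U (x - s)).
  by move=> x; have [s [u [Ss Uu ->]]] := dec x; exists s; rewrite addrC addKr.
have quniq x s : S s -> U (x - s) -> q x = s.
  move=> Ss Us; have [Sq Uq] := qP x; apply/eqP; rewrite -subr_eq0; apply/eqP.
  apply: US0; first exact: subspaceB.
  have -> : q x - s = (x - s) - (x - q x) by rewrite opprB [RHS]addrC addrA subrK.
  exact: subspaceB.
exists q; split.
- move=> a x y; have [Sx Ux] := qP x; have [Sy Uy] := qP y.
  apply: quniq; first exact: hS.2.
  suff -> : a *: x + y - (a *: q x + q y) = a *: (x - q x) + (y - q y) by exact: hU.2.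
  by rewrite opprD addrACA scalerBr.
- by move=> x; have [] := qP x.
- by move=> x Sx; apply: quniq => //; rewrite subrr; exact: subspace0.
- by move=> x Tx; apply: quniq; [exact: subspace0|rewrite subr0; exact: TU].
Qed.

End Subspaces.

(** * Direct sums and normalised decompositions *)

Section DirectSums.
Variables (K : fieldType) (V : lmodType K) (I : eqType) (D : I -> V -> Prop).
Hypothesis hD : forall i, subspace (D i).

(** Normal form of [sum_of], which admits repeated indices: coefficients vanish off a duplicate-free
    support, so decompositions with different supports can be compared on the union. *)
Definition components (P : I -> Prop) (v : V) (s : seq I) (c : I -> V) :=
  [/\ uniq s, forall i, i \in s -> P i, forall i, D i (c i),
      forall i, i \notin s -> c i = 0 & v = \sum_(i <- s) c i].

Lemma sum_components (W : lmodType K) (g : I -> V -> W) (s t : seq I) (c : I -> V) :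
    (forall i, g i 0 = 0) -> uniq s -> uniq t -> {subset s <= t} ->
    (forall i, i \notin s -> c i = 0) ->
  \sum_(i <- t) g i (c i) = \sum_(i <- s) g i (c i).
Proof.
move=> g0 us ut st c0; rewrite (bigID (mem s)) /= [X in _ + X]big1 ?addr0; last first.
  by move=> i /c0 ->.
rewrite -big_filter; apply: perm_big; apply: uniq_perm => //; first exact: filter_uniq.
by move=> i; rewrite mem_filter; case si: (i \in s) => //=; exact: st.
Qed.

Lemma sum_of_components P v : sum_of P D v -> exists s c, components P v s c.
Proof.
move=> [s [g [Ps [Dg ->]]]].
(* Repeated occurrences of [i] are merged by multiplying [g i] by its multiplicity in [s]. *)
exists (undup s), (fun i => (count_mem i s)%:R *: g i); split.
- exact: undup_uniq.
- by move=> i; rewrite mem_undup; exact: Ps.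
- by move=> i; apply: subspaceZ.
- by move=> i; rewrite mem_undup => /count_memPn ->; rewrite scale0r.
- rewrite -big_undup_iterop_count; apply: eq_bigr => i _.
  by rewrite scaler_nat Monoid.iteropE; elim: (count _ _) => [|k IH] /=; rewrite ?mulr0n ?mulrS ?IH.
Qed.

Lemma components_lin P a v s c w t e : components P v s c -> components P w t e ->
  components P (a *: v + w) (undup (s ++ t)) (fun i => a *: c i + e i).
Proof.
move=> [us Ps Dc c0 ->] [ut Pt De e0 ->]; split.
- exact: undup_uniq.
- by move=> i; rewrite mem_undup mem_cat => /orP[/Ps|/Pt].
- by move=> i; apply: (hD i).2.
- move=> i; rewrite mem_undup mem_cat negb_or => /andP[/c0 -> /e0 ->].
  by rewrite scaler0 addr0.
- rewrite big_split /= -scaler_sumr.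
  have uu := undup_uniq (s ++ t).
  congr (_ *: _ + _); apply/esym; apply: (@sum_components V (fun _ x => x)) => // i si.
    by rewrite mem_undup mem_cat si.
  by rewrite mem_undup mem_cat si orbT.
Qed.

Lemma components_sum_of P v s c : components P v s c -> sum_of P D v.
Proof. by move=> [_ Ps Dc _ ->]; exists s, c. Qed.

Lemma subspace_sum_of P : subspace (sum_of P D).
Proof.
split; first by exists [::], (fun=> 0); rewrite big_nil; split=> //; split=> // i; case: (hD i).
move=> a v w /sum_of_components[s [c sc]] /sum_of_components[t [e te]].
exact: components_sum_of (components_lin a sc te).
Qed.

Lemma sum_of1 (P : I -> Prop) i x : P i -> D i x -> sum_of P D x.
Proof.
move=> Pi Dx; exists [:: i], (fun j => if j == i then x else 0); split.
  by move=> j; rewrite inE => /eqP ->.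
split; last by rewrite big_seq1 eqxx.
by move=> j; case: eqP => [->|_] //; case: (hD j).
Qed.

Lemma sum_of_sub (P : I -> Prop) (S : V -> Prop) v : subspace S ->
  (forall i x, P i -> D i x -> S x) -> sum_of P D v -> S v.
Proof.
by move=> hS DS [s [g [Ps [Dg ->]]]]; apply: subspace_sum => // i /Ps Pi; exact: (DS i).
Qed.

End DirectSums.

Lemma sum_of_equiv (K : fieldType) (V : lmodType K) (I : eqType)
    (P P' : I -> Prop) (D : I -> V -> Prop) v :
  (forall i, P i -> P' i) -> sum_of P D v -> sum_of P' D v.
Proof. by move=> PP' [s [g [Ps H]]]; exists s, g; split=> // i /Ps /PP'. Qed.

(** * Linear maps defined on the summands of a direct sum *)

Section LinearExtension.
Variables (K : fieldType) (V : lmodType K) (I : eqType) (D : I -> V -> Prop).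
Hypothesis dD : dsum D.

Lemma linear_eq_on_dsum (W : lmodType K) (g h : V -> W) : linearP g -> linearP h ->
  (forall i x, D i x -> g x = h x) -> forall x, g x = h x.
Proof.
move=> gL hL gh x; have [_ [/(_ x) Dx _]] := dD.
apply: (sum_of_sub (S := fun x => g x = h x)) Dx => [|i y _ Dy]; last exact: gh Dy.
split; first by rewrite !lmap0.
by move=> a y z gy gz; rewrite gL hL gy gz.
Qed.

Lemma linear_extension (W : lmodType K) (g : I -> V -> W) :
    (forall i, linearP (g i)) ->
  exists h : V -> W, linearP h /\ forall i x, D i x -> h x = g i x.
Proof.
move=> gL; have [hD [Dspan Dfree]] := dD.
pose T (_ : I) := True.
pose R v w := exists s c, components D T v s c /\ w = \sum_(i <- s) g i (c i).
have g0 i : g i 0 = 0 by exact: lmap0.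
have [|h hP] := @choice _ _ R.
  move=> v; have [s [c sc]] := sum_of_components hD (Dspan v).
  by exists (\sum_(i <- s) g i (c i)), s, c.
(* The value does not depend on the decomposition: the difference of two decompositions of [v]
   decomposes [0], so all components agree. *)
have hval v s c : components D T v s c -> h v = \sum_(i <- s) g i (c i).
  move=> sc; have [t [e [te ->]]] := hP v.
  have [us _ _ c0 vs] := sc; have [ut _ _ e0 vt] := te.
  have [uu _ Du u0 vu] := components_lin hD (-1) sc te.
  rewrite scaleN1r addNr in vu.
  have ce i : c i = e i.
    have [iu|/u0] := boolP (i \in undup (s ++ t)).
      have /eqP := Dfree _ _ uu Du (esym vu) i iu.
      by rewrite scaleN1r addrC subr_eq0 => /eqP.
    by move/eqP; rewrite scaleN1r addrC subr_eq0 => /eqP.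
  rewrite -(@sum_components _ _ _ W g t (undup (s ++ t))) //.
  - rewrite -(@sum_components _ _ _ W g s (undup (s ++ t))) //.
    + by apply: eq_bigr => i _; rewrite ce.
    + by move=> i si; rewrite mem_undup mem_cat si.
  - by move=> i si; rewrite mem_undup mem_cat si orbT.
exists h; split.
  move=> a x y; have [s [c [sc ->]]] := hP x; have [t [e [te ->]]] := hP y.
  rewrite (hval _ _ _ (components_lin hD a sc te)).
  have [us _ _ c0 _] := sc; have [ut _ _ e0 _] := te.
  under eq_bigr => i _ do rewrite gL.
  rewrite big_split /= -scaler_sumr.
  have uu := undup_uniq (s ++ t).
  congr (_ *: _ + _); apply: (@sum_components _ _ _ W g) => // i si.
    by rewrite mem_undup mem_cat si.
  by rewrite mem_undup mem_cat si orbT.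
move=> i x Dx; rewrite (hval x [:: i] (fun j => if j == i then x else 0)).
  by rewrite big_seq1 eqxx.
split=> //; last by rewrite big_seq1 eqxx.
  by move=> j; case: eqP => [->|_] //; case: (hD j).
by move=> j; rewrite inE => /negbTE ->.
Qed.

End LinearExtension.

(** * Filtrations and their splittings into bigraded pieces *)

Section Filtrations.
Variables (K : fieldType) (V : lmodType K).

Lemma index_cast (G : int -> int -> V -> Prop) p p' n n' x :
  p = p' -> n = n' -> G p n x -> G p' n' x.
Proof. by move=> -> ->. Qed.

Definition filtration (deg : int -> V -> Prop) (G : int -> int -> V -> Prop) :=
  [/\ dsum deg, forall p n, subspace (G p n), forall p n x, G p n x -> deg n x,
      forall p n x, G (p + 1) n x -> G p n x &
      (forall n x, deg n x -> exists p, G p n x) /\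
      (forall n, exists p, forall x, G p n x -> x = 0)].

Variables (deg : int -> V -> Prop) (G : int -> int -> V -> Prop).
Hypothesis fG : filtration deg G.

Lemma filtration_le p q n x : p <= q -> G q n x -> G p n x.
Proof.
have [_ _ _ Gdec _] := fG.
move=> pq; have -> : q = p + `|q - p|%N%:Z by lia.
elim: `|_|%N => [|k IH]; first by rewrite addr0.
by rewrite -addn1 PoszD addrA => /Gdec.
Qed.

Section Splitting.
Variable Q : int -> int -> V -> Prop.
Hypothesis hQ : forall p q, subspace (Q p q).
Hypothesis QG : forall p q x, Q p q x -> G p (p + q) x.
Hypothesis GQ : forall p q x, G p (p + q) x ->
  exists2 y, Q p q y & G (p + 1) (p + q) (x - y).
Hypothesis QG0 : forall p q x, Q p q x -> G (p + 1) (p + q) x -> x = 0.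

Let Qi (pq : int * int) := Q pq.1 pq.2.
Let hQi i : subspace (Qi i). Proof. exact: hQ. Qed.

(** Peel off the [Q]-component at one filtration step after another. This stops because the
    filtration of degree [n] vanishes from some [p0] on; the induction is on the distance from [p]
    to [p0]. *)
Lemma filtration_bifilt p n x : G p n x <-> bifilt Q p n x.
Proof.
have [_ hG _ _ [_ Gbd]] := fG; split; last first.
  apply: sum_of_sub => // -[p' q'] y /= [<- pp'] /QG; exact: filtration_le.
have [p0 Gp0] := Gbd n; have [k] := ubnP `|p0 - p|%N.
elim: k => // k IH in p x * => kp Gx.
have [p0p|pp0] := leP p0 p.
  by rewrite (Gp0 x (filtration_le p0p Gx)); apply: subspace0; apply: subspace_sum_of.
have nE : n = p + (n - p) by lia.
rewrite nE in Gx; have [y Qy Gxy] := GQ Gx; rewrite -nE in Gxy.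
rewrite -(subrK y x); apply: subspaceD; first exact: subspace_sum_of.
  have : bifilt Q (p + 1) n (x - y) by apply: IH => //; lia.
  by apply: sum_of_equiv => -[p' q'] /= []; lia.
by apply: (@sum_of1 _ _ _ _ hQi _ (p, n - p)); rewrite //=; split=> //; lia.
Qed.

Lemma filtration_bideg n x : deg n x <-> bideg Q n x.
Proof.
have [[hdeg _] _ Gdeg _ [Gex _]] := fG; split; last first.
  by apply: sum_of_sub => // -[p' q'] y /= <- /QG /Gdeg.
by move=> /Gex[p /filtration_bifilt]; apply: sum_of_equiv => -[p' q'] /= [].
Qed.

Lemma exists_lowest (s : seq (int * int)) : s != [::] ->
  exists2 i, i \in s & forall j, j \in s -> i.1 <= j.1.
Proof.
elim: s => // a s IH _; have [->|/IH[i si imin]] := eqVneq s [::].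
  by exists a; rewrite ?mem_head // => j; rewrite inE => /eqP ->.
have [ai|ia] := leP a.1 i.1.
  exists a; rewrite ?mem_head // => j; rewrite inE => /orP[/eqP ->//|/imin].
  exact: le_trans.
exists i; rewrite ?inE ?si ?orbT // => j; rewrite inE => /orP[/eqP ->|/imin//].
exact: ltW.
Qed.

Lemma filtration_dsum : dsum (fun pq : int * int => Q pq.1 pq.2).
Proof.
have [ddeg hG Gdeg _ [Gex _]] := fG; have [hdeg [degspan degfree]] := ddeg.
split=> //; split.
  move=> v; apply: (@sum_of_sub _ _ _ deg _ _ _ _ _ (degspan v)).
    exact: subspace_sum_of.
  by move=> n x _ /filtration_bideg; exact: sum_of_equiv.
move=> s g; have [k] := ubnP (size s); elim: k => // k IH in s * => ks us Qg gs0.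
have [->//|/exists_lowest[i0 si0 i0min]] := eqVneq s [::].
(* Project the relation to the total degree [p + q] of a term of lowest filtration index. The other
   terms of that degree have strictly larger index, so [g i0] lies in [G (p + 1)], which meets
   [Q p q] only in [0]. *)
have gi0 : g i0 = 0.
  case: i0 si0 i0min => p q si0 i0min.
  have [|pr [prL prE]] := linear_extension ddeg
      (g := fun n => if n == p + q then id else fun=> 0).
    by move=> n a x y; case: eqP => //; rewrite scaler0 addr0.
  apply: (@QG0 p q); first exact: Qg (p, q).
  have gdeg j : deg (j.1 + j.2) (g j) by apply: (@Gdeg j.1); apply: QG; apply: Qg.
  have := congr1 pr gs0; rewrite lmap_sum // (bigD1_seq _ si0 us) /= lmap0 //.
  rewrite (prE _ _ (gdeg (p, q))) /= eqxx => /eqP.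
  rewrite addr_eq0 => /eqP ->; apply: subspaceN => //.
  rewrite -big_filter; apply: subspace_sum => // j; rewrite mem_filter.
  move=> /andP[jp sj]; rewrite (prE _ _ (gdeg j)).
  case: eqP => [jpq|_]; last exact: subspace0.
  rewrite -jpq; apply: (@filtration_le _ j.1); last by apply: QG; apply: Qg.
  have := i0min _ sj; rewrite le_eqVlt => /orP[/eqP /= pj|/=]; last by lia.
  by case: j jp sj jpq pj => p' q' /= /eqP ne _ ? ?; case: ne; congr (_, _); lia.
move=> i si; have [->//|ne] := eqVneq i i0.
apply: (IH (rem i0 s)); rewrite ?rem_uniq ?(mem_rem_uniq _ us) ?inE ?ne //.
  by rewrite (size_rem si0); case: s si0 ks {us gs0 i0min si}.
by rewrite (rem_filter _ us) big_filter; move: gs0; rewrite (bigD1_seq _ si0 us) /= gi0 add0r.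
Qed.

End Splitting.

(** Each piece is the kernel, inside [G p], of a projector onto [G (p + 1)]. *)
Lemma exists_bigrading : exists Q : int -> int -> V -> Prop,
  [/\ dsum (fun pq : int * int => Q pq.1 pq.2),
      forall p q x, Q p q x -> G p (p + q) x,
      forall p n x, G p n x <-> bifilt Q p n x & forall n x, deg n x <-> bideg Q n x].
Proof.
have [_ hG _ Gdec _] := fG.
have [|pr prP] := @choice (int * int) _ (fun i (q : V -> V) =>
  [/\ linearP q, forall x, G (i.1 + 1) i.2 (q x) & forall x, G (i.1 + 1) i.2 x -> q x = x]).
  move=> i; have [|||q [? ? ? _]] := @linear_projector _ V (G (i.1 + 1) i.2) (fun x => x = 0);
    rewrite ?hG //; last by exists q.
  by split=> // a x y -> ->; rewrite scaler0 addr0.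
pose Q p q x := G p (p + q) x /\ pr (p, p + q) x = 0.
have hQ p q : subspace (Q p q).
  by apply: subspaceI => //; apply: subspace_kernel; have [] := prP (p, p + q).
have QG p q x : Q p q x -> G p (p + q) x by case.
have GQ p q x : G p (p + q) x -> exists2 y, Q p q y & G (p + 1) (p + q) (x - y).
  move=> Gx; have [prL prG prid] := prP (p, p + q).
  exists (x - pr (p, p + q) x); last by rewrite subKr; exact: prG.
  split; first by apply: subspaceB => //; apply: Gdec; exact: prG.
  by rewrite lmapB // [pr _ (pr _ _)]prid ?subrr //; exact: prG.
have QG0 p q x : Q p q x -> G (p + 1) (p + q) x -> x = 0.
  by move=> [_ x0] Gx; have [_ _ prid] := prP (p, p + q); rewrite -x0 prid.
exists Q; split=> //; first exact: filtration_dsum.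
- by move=> p n x; exact: filtration_bifilt.
- by move=> n x; exact: filtration_bideg.
Qed.

End Filtrations.

(** * The filtered homotopy of a filtered complex *)

Section Contraction.
Variables (K : fieldType) (V : lmodType K).
Variables (deg : int -> V -> Prop) (G : int -> int -> V -> Prop) (d : V -> V).
Hypothesis fG : filtration deg G.
Hypothesis dL : linearP d.
Hypothesis dG : forall p n x, G p n x -> G p (n + 1) (d x).
Hypothesis dd : forall x, d (d x) = 0.

Let hG p n : subspace (G p n). Proof. by case: fG. Qed.
Let Gdec p n x : G (p + 1) n x -> G p n x. Proof. by case: fG => _ _ _ + _; exact. Qed.

Let zero_subspace : subspace (fun x : V => x = 0).
Proof. by split=> // a x y -> ->; rewrite scaler0 addr0. Qed.

(** [Z] consists of the representatives of [d_0]-cocycles; its complement in [G p] is the kernel of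
    a projector onto [Z]. *)
Lemma cycle_complement p n : exists C : V -> Prop, [/\ subspace C,
  forall x, C x -> G p n x,
  forall x, G p n x -> exists2 c, C c & G (p + 1) (n + 1) (d (x - c)) &
  forall x, C x -> G (p + 1) (n + 1) (d x) -> x = 0].
Proof.
pose Z x := G p n x /\ G (p + 1) (n + 1) (d x).
have hZ : subspace Z by apply: subspaceI => //; exact: subspace_preimage.
have [|q [qL qZ qid _]] := linear_projector hZ zero_subspace; first by move=> x _.
exists (fun x => G p n x /\ q x = 0); split.
- by apply: subspaceI => //; exact: subspace_kernel.
- by move=> x [].
- move=> x Gx; exists (x - q x); last by rewrite subKr; case: (qZ x).
  split; first by apply: subspaceB => //; case: (qZ x).
  by rewrite lmapB // (qid (q x)) // subrr.
- by move=> x [Gx q0] Gdx; rewrite -q0 qid.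
Qed.

(* [C p n] represents a complement of the [d_0]-cocycles of the associated
   graded; [h] inverts [d] on each [d (C p n)] and vanishes on [C p n]. *)
Lemma filtered_contraction : exists h : V -> V, [/\ linearP h,
  forall p n x, G p n x -> G p (n - 1) (h x), forall x, h (h x) = 0,
  forall x, h (d (h x)) = h x &
  forall p n x, G p n x -> G (p + 1) (n + 1) (d x - d (h (d x)))].
Proof.
have [C0 C0P] := choice (fun i : int * int => cycle_complement i.1 i.2).
pose C p n := C0 (p, n).
have hC p n : subspace (C p n) by case: (C0P (p, n)).
have CG p n x : C p n x -> G p n x by case: (C0P (p, n)) => _ + _ _; exact.
have GC p n x : G p n x -> exists2 c, C p n c & G (p + 1) (n + 1) (d (x - c)).
  by case: (C0P (p, n)) => _ _ + _; exact.
have CZ p n x : C p n x -> G (p + 1) (n + 1) (d x) -> x = 0.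
  by case: (C0P (p, n)) => _ _ _; exact.
have dCG p n x : C p (n - 1) x -> G p n (d x) by move=> /CG/dG; rewrite subrK.
have dCZ p n x : C p (n - 1) x -> G (p + 1) n (d x) -> x = 0.
  by move=> Cx Gx; apply: CZ Cx _; rewrite subrK.
(* [C] and [d C] are independent modulo [G (p + 1)]: if [d c'] agrees with [c], then applying [d]
   shows that [c] represents a cocycle, so [c = 0], and then [c'] represents one too. *)
have CdC p n c c' : C p n c -> C p (n - 1) c' -> G (p + 1) n (d c' - c) ->
    c = 0 /\ c' = 0.
  move=> Cc Cc' Gcc'; have c0 : c = 0.
    apply: (CZ p n) => //; rewrite -[d c]opprK; apply: subspaceN => //.
    by rewrite -sub0r -(dd c') -lmapB //; exact: dG.
  by split=> //; apply: (dCZ p n) => //; rewrite c0 subr0 in Gcc'.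
pose dC p n y := exists2 c, C p (n - 1) c & y = d c.
have hdC p n : subspace (dC p n) by exact: subspace_image.
(* The local homotopy: a projector onto [d C] killing [C] and [G (p + 1)], followed by the inverse
   of [d] on [C], where [d] is injective. *)
have gex p n : exists g : V -> V, [/\ linearP g,
    forall x, C p n x \/ G (p + 1) n x -> g x = 0,
    forall c, C p (n - 1) c -> g (d c) = c & forall x, C p (n - 1) (g x)].
  have [|q [qL qS qid q0]] := linear_projector (hdC p n)
      (subspace_add (hG (p + 1) n) (hC p n)).
    move=> x [c Cc ->] [y [c' [Gy Cc' dcE]]].
    have [|_ ->] := CdC p n c' c Cc' Cc; last by rewrite lmap0.
    by rewrite dcE addrK.
  have [|g gP] := @choice _ _ (fun x c => C p (n - 1) c /\ q x = d c).
    by move=> x; have [c Cc] := qS x; exists c.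
  have guniq x c : C p (n - 1) c -> q x = d c -> g x = c.
    move=> Cc qE; have [Cg qgE] := gP x; apply/eqP; rewrite -subr_eq0; apply/eqP.
    apply: (dCZ p n); first exact: subspaceB.
    by rewrite lmapB // -qE -qgE subrr; exact: subspace0.
  exists g; split.
  - move=> a x y; have [Cx qx] := gP x; have [Cy qy] := gP y.
    by apply: guniq; [exact: (hC _ _).2|rewrite qL dL qx qy].
  - move=> x xT; apply: guniq; first exact: subspace0.
    rewrite lmap0 // q0 //; case: xT => [Cx|Gx].
      by exists 0, x; rewrite add0r; split=> //; exact: subspace0.
    by exists x, 0; rewrite addr0; split=> //; exact: subspace0.
  - by move=> c Cc; apply: guniq => //; apply: qid; exists c.
  - by move=> x; case: (gP x).
have [g0 g0P] := choice (fun i : int * int => gex i.1 i.2).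
(* The complement of [G (p + 1)] in [G p] is chosen to contain both [C] and [d C], so that a map
   defined piecewise on the [Q p q] takes the intended values on both. *)
have Qex p q : exists Q : V -> Prop, [/\ subspace Q, forall x, Q x -> G p (p + q) x,
    forall x, G p (p + q) x -> exists2 y, Q y & G (p + 1) (p + q) (x - y),
    forall x, Q x -> G (p + 1) (p + q) x -> x = 0 &
    forall x, C p (p + q) x \/ dC p (p + q) x -> Q x].
  set n := p + q.
  have [|pr [prL prG prid pr0]] := linear_projector (hG (p + 1) n)
      (subspace_add (hdC p n) (hC p n)).
    move=> x Gx [_ [c [[c' Cc' ->] Cc xE]]].
    have [||/eqP + c'0] := CdC p n (- c) c' _ Cc'.
    - exact: subspaceN.
    - by rewrite opprK -xE.
    - by rewrite xE oppr_eq0 c'0 lmap0 // add0r => /eqP.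
  exists (fun x => G p n x /\ pr x = 0); split.
  - by apply: subspaceI => //; exact: subspace_kernel.
  - by move=> x [].
  - move=> x Gx; exists (x - pr x); last by rewrite subKr; exact: prG.
    split; first by apply: subspaceB => //; exact/Gdec/prG.
    by rewrite lmapB // (prid (pr x)) // subrr.
  - by move=> x [_ x0] Gx; rewrite -x0 prid.
  - move=> x [Cx|[c Cc ->]]; (split; [by [exact: CG|exact: dCG]|apply: pr0]).
      by exists 0, x; rewrite add0r; split=> //; exact: subspace0.
    by exists (d c), 0; rewrite addr0; split=> //; [exists c|exact: subspace0].
have [Q0 Q0P] := choice (fun i : int * int => Qex i.1 i.2).
pose Q p q := Q0 (p, q).
have dQ : dsum (fun pq : int * int => Q pq.1 pq.2).
  apply: (filtration_dsum fG) => p q; by case: (Q0P (p, q)).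
have QG p n x : G p n x -> bifilt Q p n x.
  move=> Gx; apply/(filtration_bifilt fG) => //; move=> p' q'; by case: (Q0P (p', q')).
have [|h [hL hE]] := linear_extension dQ (g := fun i => g0 (i.1, i.1 + i.2)).
  by move=> i; case: (g0P (i.1, i.1 + i.2)).
have hEn p n x : Q p (n - p) x -> h x = g0 (p, n) x.
  by move=> /(hE (p, n - p)) /=; rewrite addrC subrK.
have CQ p n x : C p n x \/ dC p n x -> Q p (n - p) x.
  move=> xC; have [_ _ _ _] := Q0P (p, n - p); apply; rewrite /= addrC subrK //.
have hC0 p n x : C p n x -> h x = 0.
  move=> Cx; rewrite (hEn p n); last by apply: CQ; left.
  by have [_ g0z _ _] := g0P (p, n); apply: g0z; left.
have hdc p n c : C p n c -> h (d c) = c.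
  move=> Cc; have Cc' : C p (n + 1 - 1) c by rewrite addrK.
  rewrite (hEn p (n + 1)); last by apply: CQ; right; exists c.
  by have [_ _ gd _] := g0P (p, n + 1); apply: gd.
have hQC p q x : Q p q x -> C p (p + q - 1) (h x).
  by move=> Qx; rewrite (hE (p, q)) //; have [_ _ _] := g0P (p, p + q); apply.
have hGG p n x : G p n x -> G p (n - 1) (h x).
  move=> /QG; apply: (sum_of_sub (S := fun y => G p (n - 1) (h y))).
    exact: subspace_preimage.
  by move=> [p' q'] y /= [<- pp'] /hQC/CG; exact: (filtration_le fG).
exists h; split=> //.
- apply: (linear_eq_on_dsum dQ) => [a x y|a x y|i x Qx]; first by rewrite !hL.
    by rewrite scaler0 addr0.
  exact/hC0/hQC/Qx.
- apply: (linear_eq_on_dsum dQ) => // [a x y|i x Qx]; first by rewrite hL dL hL.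
  exact/hdc/hQC/Qx.
(* On [C] one has [d h d = d] exactly, so the defect of [x] equals that of [x - c], and [d (x - c)]
   already lies in [G (p + 1)]. *)
- move=> p n x Gx; have [c Cc Gxc] := GC p n x Gx.
  have -> : d x - d (h (d x)) = d (x - c) - d (h (d (x - c))).
    rewrite !(lmapB dL) !(lmapB hL) !(lmapB dL) (hdc p n c) //.
    by rewrite opprB addrA subrK.
  apply: subspaceB => //.
  by apply: dG; rewrite -[n](addrK 1); exact: hGG.
Qed.

End Contraction.

(** * Sums over the deconcatenations of a word *)

Section Deconcatenation.
Variables (K : fieldType) (T : Type).

(** Pairing with the coproduct of the tensor coalgebra, cuts at both ends included. The structural
    recursion keeps index arithmetic out of the bar construction; [split_sum_index] restores indices
    when signs are compared. *)
Fixpoint split_sum (W : lmodType K) (g : seq T -> seq T -> W) (xs : seq T) : W :=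
  if xs is x :: xs' then g [::] xs + split_sum (fun u v => g (x :: u) v) xs'
  else g [::] [::].

Variable W : lmodType K.
Implicit Types g : seq T -> seq T -> W.

Lemma eq_split_sum g g' xs : (forall u v, u ++ v = xs -> g u v = g' u v) ->
  split_sum g xs = split_sum g' xs.
Proof.
elim: xs g g' => [|x xs IH] g g' gg' /=; first exact: gg'.
by rewrite gg' //; congr (_ + _); apply: IH => u v uv; apply: gg'; rewrite -uv.
Qed.

Lemma split_sumD g g' xs :
  split_sum (fun u v => g u v + g' u v) xs = split_sum g xs + split_sum g' xs.
Proof. by elim: xs g g' => [|x xs IH] g g' //=; rewrite IH addrACA. Qed.

Lemma linear_split_sum (W' : lmodType K) (h : W -> W') g xs : linearP h ->
  h (split_sum g xs) = split_sum (fun u v => h (g u v)) xs.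
Proof. by move=> hL; elim: xs g => [|x xs IH] g //=; rewrite lmapD // IH. Qed.

Lemma split_sum0 xs : split_sum (fun _ _ => 0 : W) xs = 0.
Proof. by elim: xs => [|x xs IH] //=; rewrite IH addr0. Qed.

(** A cut falls either before or after the distinguished letter [y]. *)
Lemma split_sum_cat g p y q : split_sum g (p ++ y :: q) =
  split_sum (fun p1 p2 => g p1 (p2 ++ y :: q)) p +
  split_sum (fun q1 q2 => g (p ++ y :: q1) q2) q.
Proof. by elim: p g => [|x p IH] g //=; rewrite IH addrA. Qed.

Lemma split_sum_full g xs : (forall u y v, g u (y :: v) = 0) ->
  split_sum g xs = g xs [::].
Proof. by elim: xs g => [|x xs IH] g g0 //=; rewrite g0 add0r IH. Qed.

Lemma split_sum_empty g xs : (forall x u v, g (x :: u) v = 0) ->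
  split_sum g xs = g [::] xs.
Proof.
case: xs => [|x xs] g0 //=; rewrite -[RHS]addr0; congr (_ + _).
by rewrite -[RHS](split_sum0 xs); apply: eq_split_sum.
Qed.

Lemma split_sum_map (t : T -> T) g xs :
  split_sum g (map t xs) = split_sum (fun u v => g (map t u) (map t v)) xs.
Proof. by elim: xs g => [|x xs IH] g //=; rewrite IH. Qed.

Lemma split_sum_coassoc (k : seq T -> seq T -> seq T -> W) xs :
  split_sum (fun u w => split_sum (fun u1 u2 => k u1 u2 w) u) xs =
  split_sum (fun u v => split_sum (fun v1 v2 => k u v1 v2) v) xs.
Proof.
elim: xs k => [|x xs IH] k //=.
by rewrite split_sumD (IH (fun u1 => k (x :: u1))) addrA.
Qed.

Lemma split_sum_exchange (k : seq T -> seq T -> seq T -> seq T -> W) xs ys :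
  split_sum (fun u v => split_sum (k u v) ys) xs =
  split_sum (fun w z => split_sum (fun u v => k u v w z) xs) ys.
Proof. by elim: xs k => [|x xs IH] k //=; rewrite (IH (fun u => k (x :: u))) -split_sumD. Qed.

Lemma split_sum_index g xs :
  split_sum g xs = \sum_(i < (size xs).+1) g (take i xs) (drop i xs).
Proof.
elim: xs g => [|x xs IH] g /=; first by rewrite big_ord_recl big_ord0 addr0.
by rewrite big_ord_recl /= IH.
Qed.

End Deconcatenation.

Lemma scale_linear (K : fieldType) (W : lmodType K) (a : K) : linearP (fun x : W => a *: x).
Proof. by move=> c x y; rewrite scalerDr !scalerA mulrC. Qed.

(** * Homotopy transfer in the bar construction *)
Section BarTransfer.
Variables (K : fieldType) (V : lmodType K).
Variables (d H t : V -> V) (b : V -> V -> V).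
Hypothesis dL : linearP d.
Hypothesis HL : linearP H.
Hypothesis tL : linearP t.
Hypothesis bL : bilinearP b.
Hypothesis dd : forall x, d (d x) = 0.
Hypothesis db : forall x y, d (b x y) = - (b (d x) y + b (t x) (d y)).
Hypothesis bb : forall x y z, b (b x y) z + b (t x) (b y z) = 0.
Hypothesis tb : forall x y, t (b x y) = - b (t x) (t y).
Hypothesis tH : forall x, t (H x) = - H (t x).

(** For [H = - h] this is [1 - d h - h d]. *)
Definition retract (x : V) := x + d (H x) + H (d x).

Definition single (xs : seq V) : V := if xs is [:: x] then x else 0.

Definition bar_prod (F : seq V -> V) (xs : seq V) : V :=
  split_sum (fun u v => b (F u) (F v)) xs.

(* The recursion for [bar_F] is well founded only because the empty word is
   sent to [0], which is why it is unrolled [size xs] times. *)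
Fixpoint bar_F_rec (k : nat) (xs : seq V) : V :=
  if k is k'.+1 then single xs + H (bar_prod (bar_F_rec k') xs) else 0.

Definition bar_F xs := bar_F_rec (size xs) xs.
Definition bar_L := bar_prod bar_F.
Definition bar_B xs := d (single xs) + retract (bar_L xs).

Let b0l y : b 0 y = 0. Proof. exact: (lmap0 (bL.1 y)). Qed.
Let b0r x : b x 0 = 0. Proof. exact: (lmap0 (bL.2 x)). Qed.

Lemma retract_linear : linearP retract.
Proof.
move=> a x y; rewrite /retract !(dL, HL) !scalerDr.
by rewrite [(a *: x + y) + _]addrACA [LHS]addrACA.
Qed.

Lemma d_retract x : d (retract x) = retract (d x).
Proof. by rewrite /retract !(lmapD dL) !dd (lmap0 HL) !addr0. Qed.

Lemma bar_F_rec_nil k : bar_F_rec k [::] = 0.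
Proof.
by elim: k => // k IH; rewrite /= /bar_prod /= IH b0l (lmap0 HL) addr0.
Qed.

(** A cut with an empty half contributes [0] because the empty word is sent to [0]; in every other
    cut both halves are shorter than [xs]. So depth [size xs] already gives the final value. *)
Lemma bar_F_rec_stable n k xs : (size xs <= n <= k)%N -> bar_F_rec k xs = bar_F_rec n xs.
Proof.
elim: n k xs => [|n IH] [|k] xs /andP[sn nk] //.
  by case: xs sn => // _; rewrite !bar_F_rec_nil.
rewrite /=; congr (_ + H _); apply: eq_split_sum => u v uvE.
have := congr1 size uvE; rewrite size_cat => suv.
case: u uvE suv => [|x u] uvE suv; first by rewrite !bar_F_rec_nil !b0l.
case: v uvE suv => [|y v] uvE suv; first by rewrite !bar_F_rec_nil !b0r.
by rewrite (IH k (x :: u)) ?(IH k (y :: v)) //; move: suv => /=; lia.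
Qed.

Lemma bar_F_nil : bar_F [::] = 0. Proof. by []. Qed.

Lemma bar_FE xs : bar_F xs = single xs + H (bar_L xs).
Proof.
rewrite /bar_F -(@bar_F_rec_stable _ (size xs).+1) ?leqnn ?leqnSn //.
move sE: (size xs) => n /=; congr (_ + H _); apply: eq_split_sum => u v uvE.
have := congr1 size uvE; rewrite size_cat sE => suv.
by congr (b _ _); apply: bar_F_rec_stable; lia.
Qed.

Lemma bar_L_nil : bar_L [::] = 0. Proof. exact: b0l. Qed.

Lemma bar_L1 x : bar_L [:: x] = 0.
Proof. by rewrite /bar_L /bar_prod /= b0l b0r addr0. Qed.

Lemma bar_F1 x : bar_F [:: x] = x.
Proof. by rewrite bar_FE bar_L1 (lmap0 HL) addr0. Qed.

Lemma bar_B_nil : bar_B [::] = 0.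
Proof. by rewrite /bar_B bar_L_nil (lmap0 dL) add0r (lmap0 retract_linear). Qed.

Lemma bar_B1 x : bar_B [:: x] = d x.
Proof. by rewrite /bar_B bar_L1 (lmap0 retract_linear) addr0. Qed.

Lemma single_multilinear : multilinear single.
Proof.
move=> [|x0 [|x1 l1]] [|x2 l2] a x y //=; rewrite ?scaler0 ?addr0 //.
Qed.

Lemma bar_prod_multilinear F : multilinear F -> multilinear (bar_prod F).
Proof.
move=> FL l1 l2 a x y; rewrite /bar_prod !split_sum_cat scalerDr.
set A1 := split_sum _ l1; set A2 := split_sum _ l2.
rewrite addrACA; congr (_ + _); rewrite {}/A1 {}/A2.
  rewrite (linear_split_sum _ _ (scale_linear a)).
  by rewrite -split_sumD; apply: eq_split_sum => u v _; rewrite FL bL.2.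
rewrite (linear_split_sum _ _ (scale_linear a)).
by rewrite -split_sumD; apply: eq_split_sum => u v _; rewrite FL bL.1.
Qed.

Lemma bar_F_rec_multilinear k : multilinear (bar_F_rec k).
Proof.
elim: k => [|k IH] l1 l2 a x y /=; first by rewrite scaler0 addr0.
by rewrite single_multilinear (bar_prod_multilinear IH) HL scalerDr addrACA.
Qed.

Lemma bar_F_multilinear : multilinear bar_F.
Proof. by move=> l1 l2 a x y; rewrite /bar_F bar_F_rec_multilinear !size_cat. Qed.

Lemma bar_L_multilinear : multilinear bar_L.
Proof. exact/bar_prod_multilinear/bar_F_multilinear. Qed.

Lemma bar_B_multilinear : multilinear bar_B.
Proof.
move=> l1 l2 a x y; rewrite /bar_B single_multilinear bar_L_multilinear dL retract_linear.
by rewrite addrACA -scalerDr.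
Qed.

Lemma t_single xs : t (single xs) = single (map t xs).
Proof. by case: xs => [|x [|? ?]] //=; rewrite (lmap0 tL). Qed.

Lemma t_bar_F xs : t (bar_F xs) = bar_F (map t xs).
Proof.
rewrite /bar_F size_map; move: (size xs) => k; elim: k xs => [|k IH] xs /=.
  exact: lmap0.
rewrite lmapD // t_single tH -lmapN //; congr (_ + H _).
rewrite /bar_prod split_sum_map (linear_split_sum _ _ tL) -scaleN1r.
rewrite (linear_split_sum _ _ (scale_linear (-1))).
by apply: eq_split_sum => u v _; rewrite tb scaleN1r opprK !IH.
Qed.

(** [g] applied after the coderivation of the tensor coalgebra determined by [bar_B]. The operator
    [t] on the prefix is the Koszul sign for moving the odd map [bar_B] past [u]. *)
Definition insert_B (g : seq V -> V) (xs : seq V) : V :=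
  split_sum (fun u y => split_sum (fun v w => g (map t u ++ bar_B v :: w)) y) xs.

Lemma insert_B_lin (h : V -> V) g xs : linearP h ->
  h (insert_B g xs) = insert_B (fun ys => h (g ys)) xs.
Proof.
move=> hL; rewrite /insert_B (linear_split_sum _ _ hL); apply: eq_split_sum => u y _.
by rewrite (linear_split_sum _ _ hL).
Qed.

Lemma insert_BD g g' xs :
  insert_B (fun ys => g ys + g' ys) xs = insert_B g xs + insert_B g' xs.
Proof.
rewrite /insert_B -split_sumD; apply: eq_split_sum => u y _; exact: split_sumD.
Qed.

Lemma eq_insert_B g g' xs : (forall ys, g ys = g' ys) -> insert_B g xs = insert_B g' xs.
Proof. by move=> gg'; apply: eq_split_sum => u y _; apply: eq_split_sum. Qed.

Lemma insert_B_single xs : insert_B single xs = bar_B xs.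
Proof.
rewrite /insert_B split_sum_empty /=.
  by rewrite split_sum_full.
move=> x u v; rewrite -[RHS](split_sum0 _ v); apply: eq_split_sum => y w _ /=.
by case: (map t u).
Qed.

Lemma insert_B_nil g : multilinear g -> insert_B g [::] = 0.
Proof.
move=> gL; rewrite /insert_B /= bar_B_nil.
have := gL [::] [::] (-1) 0 0.
by rewrite /= scaler0 addr0 scaleN1r addNr.
Qed.

(** The insertion happens either left or right of the cut made by the product; on the right, the
    signs on the whole left word combine into one [t] because [t] commutes with [bar_F]. *)
Lemma insert_B_prod xs : insert_B bar_L xs =
  split_sum (fun u v => b (insert_B bar_F u) (bar_F v) +
                        b (t (bar_F u)) (insert_B bar_F v)) xs.
Proof.
pose g u v := b (bar_F u) (bar_F v).
rewrite split_sumD addrC /insert_B.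
transitivity (split_sum (fun u y => split_sum (fun v w =>
    split_sum (fun u1 u2 => g (map t u1) (map t u2 ++ bar_B v :: w)) u) y +
  split_sum (fun v w =>
    split_sum (fun w1 w2 => g (map t u ++ bar_B v :: w1) w2) w) y) xs).
  apply: eq_split_sum => u y _; rewrite -split_sumD; apply: eq_split_sum => v w _.
  by rewrite /bar_L /bar_prod split_sum_cat split_sum_map.
rewrite split_sumD; congr (_ + _).
  transitivity (split_sum (fun u y => split_sum (fun u1 u2 => split_sum (fun v w =>
      g (map t u1) (map t u2 ++ bar_B v :: w)) y) u) xs).
    by apply: eq_split_sum => u y _; rewrite split_sum_exchange.
  rewrite (split_sum_coassoc (fun u1 u2 y => split_sum (fun v w =>
      g (map t u1) (map t u2 ++ bar_B v :: w)) y)).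
  apply: eq_split_sum => u v _; rewrite t_bar_F (linear_split_sum _ _ (bL.2 _)).
  by apply: eq_split_sum => u2 y _; rewrite (linear_split_sum _ _ (bL.2 _)).
transitivity (split_sum (fun z w2 => split_sum (fun u z' => split_sum (fun v w1 =>
    g (map t u ++ bar_B v :: w1) w2) z') z) xs).
  rewrite (split_sum_coassoc (fun u z' w2 => split_sum (fun v w1 =>
    g (map t u ++ bar_B v :: w1) w2) z')); apply: eq_split_sum => u y _.
  by rewrite (split_sum_coassoc (fun v w1 w2 => g (map t u ++ bar_B v :: w1) w2)).
apply: eq_split_sum => u v _; rewrite (linear_split_sum _ _ (bL.1 _)).
by apply: eq_split_sum => u2 y _; rewrite (linear_split_sum _ _ (bL.1 _)).
Qed.

Lemma d_bar_L xs : - d (bar_L xs) =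
  split_sum (fun u v => b (d (bar_F u)) (bar_F v) + b (t (bar_F u)) (d (bar_F v))) xs.
Proof.
rewrite /bar_L /bar_prod (linear_split_sum _ _ dL) -scaleN1r.
rewrite (linear_split_sum _ _ (scale_linear (-1))).
by apply: eq_split_sum => u v _; rewrite db scaleN1r opprK.
Qed.

(** By coassociativity both halves become sums over cuts into three words, where the terms cancel by
    the associativity relation for [b]. *)
Lemma bar_L_assoc xs :
  split_sum (fun u v => b (bar_L u) (bar_F v) + b (t (bar_F u)) (bar_L v)) xs = 0.
Proof.
rewrite split_sumD.
transitivity (split_sum (fun u y => split_sum (fun v w =>
   b (b (bar_F u) (bar_F v)) (bar_F w) + b (t (bar_F u)) (b (bar_F v) (bar_F w))) y) xs);
  last first.
  rewrite -[RHS](split_sum0 _ xs); apply: eq_split_sum => u y _.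
  by rewrite -[RHS](split_sum0 _ y); apply: eq_split_sum => v w _; exact: bb.
under [RHS]eq_split_sum => u y _ do rewrite split_sumD.
rewrite split_sumD; congr (_ + _).
  rewrite -(split_sum_coassoc (fun u v w => b (b (bar_F u) (bar_F v)) (bar_F w))).
  by apply: eq_split_sum => u v _; rewrite (linear_split_sum _ _ (bL.1 _)).
by apply: eq_split_sum => u v _; rewrite (linear_split_sum _ _ (bL.2 _)).
Qed.

(** Substituting the relation for shorter words into [insert_B_prod], the terms with [d] add up to
    [- d L] and the terms with [L] cancel by [bar_L_assoc]. *)
Lemma insert_B_L xs :
    (forall ys, (size ys < size xs)%N -> insert_B bar_F ys = d (bar_F ys) + bar_L ys) ->
  insert_B bar_L xs = - d (bar_L xs).
Proof.
move=> IH; rewrite insert_B_prod d_bar_L -[RHS]addr0 -(bar_L_assoc xs) -split_sumD.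
apply: eq_split_sum => u v uvE; have := congr1 size uvE; rewrite size_cat => suv.
rewrite [RHS]addrACA -(lmapD (bL.1 _)) -(lmapD (bL.2 _)).
have Inil : insert_B bar_F [::] = 0 by apply: insert_B_nil; exact: bar_F_multilinear.
have zero0 : 0 = d (bar_F [::]) + bar_L [::] by rewrite bar_F_nil bar_L_nil (lmap0 dL) addr0.
(* If one half is empty the other is all of [xs], out of reach of the assumption; these terms vanish
   because [bar_F] kills the empty word. *)
case: u uvE suv => [|x u] uvE suv.
  by rewrite bar_F_nil (lmap0 tL) !b0l Inil -zero0 b0l.
case: v uvE suv => [|y v] uvE suv; first by rewrite bar_F_nil Inil -zero0 !b0r.
by rewrite !IH //; move: suv => /=; lia.
Qed.

(** By induction on length, inserting into [F = single + H L] gives [B - H d L]. Expanding [B]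
    leaves [d single + L + d H L], which is [d F + L]. *)
Lemma insert_B_F xs : insert_B bar_F xs = d (bar_F xs) + bar_L xs.
Proof.
have [n] := ubnP (size xs); elim: n => // n IH in xs * => sn.
rewrite (eq_insert_B _ bar_FE) insert_BD insert_B_single -insert_B_lin //.
rewrite insert_B_L; last by move=> ys ys_lt; apply: IH; lia.
rewrite lmapN // bar_FE lmapD // /bar_B /retract.
by rewrite !addrA addrK -!addrA; congr (_ + _); rewrite addrC.
Qed.

(** Inserting into [B = d single + retract L] gives [d B - retract (d L)], and this vanishes since
    [d] squares to zero and commutes with [retract]. *)
Lemma insert_B_B xs : insert_B bar_B xs = 0.
Proof.
rewrite /bar_B insert_BD -!insert_B_lin //; last exact: retract_linear.
rewrite insert_B_single insert_B_L => [|ys _]; last exact: insert_B_F.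
rewrite /bar_B lmapD // dd add0r d_retract lmapN ?subrr //; exact: retract_linear.
Qed.

End BarTransfer.

(** * Signs with integer exponents *)

Section Signs.
Variable K : fieldType.

Lemma kozD (a c : int) : koz K (a + c) = koz K a * koz K c.
Proof.
rewrite /koz -signr_odd -[X in _ = X * _]signr_odd -[X in _ = _ * X]signr_odd -signr_addb.
by congr (_ ^+ _); congr nat_of_bool; lia.
Qed.

Lemma koz_even (a : int) : koz K (2 * a) = 1.
Proof. by rewrite /koz -signr_odd (_ : odd _ = false) //; lia. Qed.

(** Naming half the difference of the exponents turns a comparison of signs into a ring identity. *)
Lemma koz_cong (a c e : int) : a = c + 2 * e -> koz K a = koz K c.
Proof. by move=> ->; rewrite kozD koz_even mulr1. Qed.

Lemma koznE n : kozn K n = koz K n%:Z. Proof. by []. Qed.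

Lemma koz1 : koz K 1 = -1. Proof. by []. Qed.

Lemma kozK a : koz K a * koz K a = 1.
Proof. by rewrite -kozD -(koz_even a); congr koz; ring. Qed.

End Signs.

(** * Lists of homogeneous elements *)

Section HomogeneousLists.
Variables (K : fieldType) (V : lmodType K) (I : Type) (i0 : I) (D : I -> V -> Prop).

Lemma homog_cons x xs i js : homog i0 D (x :: xs) (i :: js) <-> D i x /\ homog i0 D xs js.
Proof.
split=> [[/= [sE] H]|[Dx [sE H]]].
  by split; [exact: (H 0)|split=> // k kx; exact: (H k.+1)].
by split=> [|[|k]] //=; [rewrite sE|exact: H].
Qed.

Lemma homog_nil js : homog i0 D [::] js <-> js = [::].
Proof. by split=> [[/esym/size0nil]|->]. Qed.

Lemma homog_cat_inv u v js : homog i0 D (u ++ v) js -> exists iu iv,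
  [/\ js = iu ++ iv, homog i0 D u iu & homog i0 D v iv].
Proof.
elim: u js => [|x u IH] js /=; first by exists [::], js; split=> //; exact/homog_nil.
case: js => [[]//|i js] /homog_cons[Dx /IH[iu [iv [-> hu hv]]]].
by exists (i :: iu), iv; split=> //; exact/homog_cons.
Qed.

Lemma homog_cat u v iu iv : homog i0 D u iu -> homog i0 D v iv ->
  homog i0 D (u ++ v) (iu ++ iv).
Proof.
elim: u iu => [|x u IH] [|i iu] //=; try by case.
by move=> /homog_cons[Dx hu] hv; apply/homog_cons; split=> //; exact: IH.
Qed.

Lemma homog_size u iu : homog i0 D u iu -> size u = size iu. Proof. by case. Qed.

Lemma homog_split k xs js : homog i0 D xs js ->
  homog i0 D (take k xs) (take k js) /\ homog i0 D (drop k xs) (drop k js).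
Proof.
elim: xs js k => [|x xs IH] js k.
  by move=> /homog_nil ->; split; apply/homog_nil; case: k.
case: js => [[]//|i js]; case: k => [|k] h; first by split=> //; exact/homog_nil.
by move: h => /homog_cons[Dx /(IH _ k)[hu hv]] /=; split=> //; exact/homog_cons.
Qed.

End HomogeneousLists.

Section Multilinear.
Variables (K : fieldType) (V W : lmodType K) (g : seq V -> W).
Hypothesis gL : multilinear g.

Lemma multilinear0 p q : g (p ++ 0 :: q) = 0.
Proof. by have := gL p q (-1) 0 0; rewrite scaler0 addr0 scaleN1r addNr. Qed.

Lemma multilinearZ p q a x : g (p ++ a *: x :: q) = a *: g (p ++ x :: q).
Proof. by have := gL p q a x 0; rewrite addr0 multilinear0 addr0. Qed.

End Multilinear.

Lemma sumz_cat u v : sumz (u ++ v) = sumz u + sumz v.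
Proof. exact: big_cat. Qed.

Lemma sumz_cons x u : sumz (x :: u) = x + sumz u.
Proof. exact: big_cons. Qed.

Lemma sumz_nil : sumz [::] = 0. Proof. exact: big_nil. Qed.

(* [koz (kap ds)] is the sign by which the suspension relates [m_s] to the
   bar differential. *)
Fixpoint kap (ds : seq int) : int :=
  if ds is d :: ds' then d * (size ds')%:Z + kap ds' else 0.

Lemma kap_cat u v : kap (u ++ v) = kap u + (size v)%:Z * sumz u + kap v.
Proof.
elim: u => [|d u IH] /=; first by rewrite sumz_nil mulr0 !add0r.
rewrite IH size_cat sumz_cons PoszD; ring.
Qed.

(** * Desuspension: from bar operations to signed operations *)

Section Desuspension.
Variables (K : fieldType) (V : lmodType K) (deg : int -> V -> Prop) (eps : V -> V).
Hypothesis epsL : linearP eps.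
Hypothesis epsE : forall n x, deg n x -> eps x = koz K n *: x.
Hypothesis hdeg : forall n, subspace (deg n).

(** The suspension sign as an operator: each letter receives one [eps] for every letter to its
    right, with [k] further letters assumed after the list. Being linear in each letter, it applies
    to inhomogeneous entries too. *)
Fixpoint twist (k : nat) (xs : seq V) : seq V :=
  if xs is x :: xs' then iter (size xs' + k) eps x :: twist k xs' else [::].

Lemma twist_cat k u v : twist k (u ++ v) = twist (size v + k) u ++ twist k v.
Proof. by elim: u => //= x u ->; rewrite size_cat addnA. Qed.

Lemma iter_eps_linear k : linearP (iter k eps).
Proof. by elim: k => // k IH a x y /=; rewrite IH epsL. Qed.

Lemma iter_eps k n x : deg n x -> iter k eps x = koz K (n * k%:Z) *: x.
Proof.
move=> nx; elim: k => [|k IH] /=; first by rewrite mulr0 scale1r.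
rewrite IH lmapZ // (epsE nx) scalerA -kozD; congr (koz _ _ *: _); lia.
Qed.

Lemma twist_multilinear (W : lmodType K) (g : seq V -> W) :
  multilinear g -> multilinear (fun xs => g (twist 0 xs)).
Proof. by move=> gL l1 l2 a x y; rewrite !twist_cat /= iter_eps_linear gL. Qed.

Lemma multilinear_twist (W : lmodType K) (g : seq V -> W) k p xs q ds :
    multilinear g -> homog 0 deg xs ds ->
  g (p ++ twist k xs ++ q) = koz K (kap ds + k%:Z * sumz ds) *: g (p ++ xs ++ q).
Proof.
move=> gL; elim: xs ds p => [|x xs IH] ds p.
  by move=> /homog_nil ->; rewrite sumz_nil mulr0 scale1r.
case: ds => [[]//|d ds] /homog_cons[dx hxs] /=.
rewrite (iter_eps _ dx) multilinearZ // -cat_rcons (IH ds) // cat_rcons scalerA -kozD.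
congr (koz _ _ *: _); rewrite sumz_cons (homog_size hxs) PoszD; ring.
Qed.

Lemma multilinear_map_sign (W : lmodType K) (g : seq V -> W) p xs q ds :
    multilinear g -> homog 0 deg xs ds ->
  g (p ++ map (fun x => - eps x) xs ++ q) =
    koz K (sumz ds + (size xs)%:Z) *: g (p ++ xs ++ q).
Proof.
move=> gL; elim: xs ds p => [|x xs IH] ds p.
  by move=> /homog_nil ->; rewrite sumz_nil scale1r.
case: ds => [[]//|d ds] /homog_cons[dx hxs] /=.
rewrite (epsE dx) -scaleN1r scalerA -koz1 -kozD multilinearZ //.
rewrite -cat_rcons (IH ds) // cat_rcons scalerA -kozD.
congr (koz _ _ *: _); rewrite sumz_cons; lia.
Qed.

Section InsertionSign.
Variables (W : lmodType K) (g : seq V -> W) (B : seq V -> V).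
Hypothesis gL : multilinear g.
Hypothesis BL : multilinear B.
Hypothesis B0 : B [::] = 0.
Hypothesis Bdeg : forall xs ds, homog 0 deg xs ds -> (0 < size xs)%N ->
  deg (sumz ds + 2 - (size xs)%:Z) (B xs).

Lemma insertion_term u v w du dv dw :
    homog 0 deg u du -> homog 0 deg v dv -> homog 0 deg w dw -> (0 < size v)%N ->
  (kozn K (size u + size v * size w) * koz K ((size v)%:Z * sumz du)) *:
     g (twist 0 (u ++ B (twist 0 v) :: w)) =
  koz K (kap (du ++ dv ++ dw)) *:
     g (map (fun x => - eps x) u ++ B v :: w).
Proof.
move=> hu hv hw v0.
have BE : B (twist 0 v) = koz K (kap dv) *: B v.
  by have := multilinear_twist 0 [::] [::] BL hv; rewrite /= !cats0 mul0r addr0.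
have degB : deg (sumz dv + 2 - (size v)%:Z) (B (twist 0 v)).
  by rewrite BE; apply: subspaceZ => //; exact: Bdeg.
have := multilinear_twist 0 [::] [::] gL
  (homog_cat hu ((homog_cons _ _ _ _ _ _).2 (conj degB hw))).
rewrite /= !cats0 mul0r addr0 => ->.
rewrite BE multilinearZ // (multilinear_map_sign [::] _ gL hu) !scalerA koznE -!kozD.
(* The inserted letter has degree [sumz dv + 2 - size v] and passes [size w] letters; its summand
   [2] is the whole difference between the two exponents. *)
congr (_ *: _); apply: (@koz_cong K _ _ (size w)%:Z).
rewrite !kap_cat /= size_cat -(homog_size hv) -(homog_size hw) !PoszD PoszM; ring.
Qed.

(** The signs of the A-infinity relations are thereby reduced to a common factor times the bar
    insertion. *)
Lemma ins_sum_twist xs ds : homog 0 deg xs ds ->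
  ins_sum (fun ys => g (twist 0 ys)) (fun ys => B (twist 0 ys)) xs ds =
  koz K (kap ds) *: split_sum (fun u y => split_sum (fun v w =>
     g (map (fun x => - eps x) u ++ B v :: w)) y) xs.
Proof.
move=> hxs; rewrite /ins_sum split_sum_index scaler_sumr; apply: eq_bigr => r _.
have rn : (r <= size xs)%N by rewrite -ltnS.
have [hu hvw] := homog_split r hxs.
rewrite split_sum_index size_drop scaler_sumr.
rewrite (big_ord_widen (size xs).+1 (fun s : nat => koz K (kap ds) *:
  g (map (fun x => - eps x) (take r xs) ++ B (take s (drop r xs)) :: drop s (drop r xs))));
  last by lia.
rewrite big_mkcond [RHS]big_mkcond; apply: eq_bigr => s _.
(* [ins_sum] omits empty insertions while [split_sum] includes them; they vanish because [B [::] =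
   0]. *)
have [s0|s0] := posnP s.
  by rewrite s0 /= take0 B0 multilinear0 // scaler0.
have -> : (s < (size xs - r).+1)%N = (r + s <= size xs)%N by lia.
rewrite /=; case: leqP => // rs.
have [hv hw] := homog_split s hvw.
have su : size (take r xs) = r by rewrite size_take_min; lia.
have sv : size (take s (drop r xs)) = s by rewrite size_take_min size_drop; lia.
have sw : size (drop s (drop r xs)) = (size xs - r - s)%N by rewrite !size_drop.
have := insertion_term hu hv hw; rewrite su sv sw drop_drop [(s + r)%N]addnC => -> //.
by rewrite [drop r ds](esym (cat_take_drop s _)) !cat_take_drop.
Qed.

End InsertionSign.

End Desuspension.

Lemma filtered_dga_filtration (K : fieldType) (V : lmodType K) (deg : int -> V -> Prop)
    (G : int -> int -> V -> Prop) (d : V -> V) (mu : V -> V -> V) :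
  is_filtered_dga deg G d mu -> filtration deg G.
Proof. by move=> [[ddeg _] [hG [Gdeg [Gdec [_ [_ [Gex Gbd]]]]]]]; split. Qed.

Lemma exists_parity (K : fieldType) (V : lmodType K) (deg : int -> V -> Prop) :
  dsum deg -> exists eps : V -> V, linearP eps /\
    forall n x, deg n x -> eps x = koz K n *: x.
Proof. by move=> /linear_extension; apply=> n; exact: scale_linear. Qed.

Lemma subspace_split_sum (K : fieldType) (T : Type) (W : lmodType K) (S : W -> Prop)
    (g : seq T -> seq T -> W) xs : subspace S ->
  (forall u v, u ++ v = xs -> S (g u v)) -> S (split_sum g xs).
Proof.
move=> hS; elim: xs g => [|x xs IH] g Sg /=; first exact: Sg.
by apply: subspaceD => //; [exact: Sg|apply: IH => u v uv; apply: Sg; rewrite -uv].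
Qed.

(** * The transferred structure on a filtered dg-algebra *)
Section TransferredStructure.
Variables (K : fieldType) (A : lmodType K).
Variables (deg : int -> A -> Prop) (G : int -> int -> A -> Prop).
Variables (d : A -> A) (mu : A -> A -> A) (eps h : A -> A).
Hypothesis fA : is_filtered_dga deg G d mu.
Hypothesis epsL : linearP eps.
Hypothesis epsE : forall n x, deg n x -> eps x = koz K n *: x.
Hypothesis hL : linearP h.
Hypothesis hG : forall p n x, G p n x -> G p (n - 1) (h x).

Let ddeg : dsum deg. Proof. by case: fA => -[]. Qed.
Let sdeg n : subspace (deg n). Proof. by case: ddeg. Qed.
Let dL : linearP d. Proof. by case: fA => -[_ []]. Qed.
Let d_deg n x : deg n x -> deg (n + 1) (d x).
Proof. by case: fA => -[_ [_ [+ _]]] _; exact. Qed.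
Let dd x : d (d x) = 0. Proof. by case: fA => -[_ [_ [_ [+ _]]]] _; exact. Qed.
Let muL : bilinearP mu. Proof. by case: fA => -[_ [_ [_ [_ []]]]]. Qed.
Let mu_deg n k x y : deg n x -> deg k y -> deg (n + k) (mu x y).
Proof. by case: fA => -[_ [_ [_ [_ [_ [+ _]]]]]] _; exact. Qed.
Let muA x y z : mu (mu x y) z = mu x (mu y z).
Proof. by case: fA => -[_ [_ [_ [_ [_ [_ [+ _]]]]]]] _; exact. Qed.
Let leib n x y : deg n x -> d (mu x y) = mu (d x) y + koz K n *: mu x (d y).
Proof. by case: fA => -[_ [_ [_ [_ [_ [_ [_ +]]]]]]] _; exact. Qed.
Let sG p n : subspace (G p n). Proof. by case: fA => _ []. Qed.
Let Gdeg p n x : G p n x -> deg n x. Proof. by case: fA => _ [_ [+ _]]; exact. Qed.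
Let dG p n x : G p n x -> G p (n + 1) (d x).
Proof. by case: fA => _ [_ [_ [_ [+ _]]]]; exact. Qed.
Let muG p q n k x y : G p n x -> G q k y -> G (p + q) (n + k) (mu x y).
Proof. by case: fA => _ [_ [_ [_ [_ [+ _]]]]]; exact. Qed.
Let Gex n x : deg n x -> exists p, G p n x.
Proof. by case: fA => _ [_ [_ [_ [_ [_ [+ _]]]]]]; exact. Qed.
Let h_deg n x : deg n x -> deg (n - 1) (h x).
Proof. by move=> /Gex[p /hG/Gdeg]. Qed.

Let kozS n : koz K (n + 1) = - koz K n.
Proof. by rewrite kozD koz1 mulrN1. Qed.

Let eps_d x : eps (d x) = - d (eps x).
Proof.
move: x; apply: (linear_eq_on_dsum ddeg) => [a x y|a x y|n x nx].
- by rewrite dL epsL.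
- by rewrite epsL dL opprD scalerN.
- by rewrite (epsE nx) lmapZ // (epsE (d_deg nx)) kozS scaleNr.
Qed.

Let eps_h x : eps (h x) = - h (eps x).
Proof.
move: x; apply: (linear_eq_on_dsum ddeg) => [a x y|a x y|n x nx].
- by rewrite hL epsL.
- by rewrite epsL hL opprD scalerN.
- rewrite (epsE nx) lmapZ // (epsE (h_deg nx)).
  by rewrite -{2}(subrK 1 n) kozS scaleNr opprK.
Qed.

Let eps_K x : eps (eps x) = x.
Proof.
move: x; apply: (linear_eq_on_dsum ddeg) => [a x y|//|n x nx]; first by rewrite !epsL.
by rewrite (epsE nx) lmapZ // (epsE nx) scalerA kozK scale1r.
Qed.

Let eps_mu x y : eps (mu x y) = mu (eps x) (eps y).
Proof.
move: x; apply: (linear_eq_on_dsum ddeg) => [a x z|a x z|n x nx].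
- by rewrite muL.1 epsL.
- by rewrite epsL muL.1.
move: y; apply: (linear_eq_on_dsum ddeg) => [a y z|a y z|k y ky].
- by rewrite muL.2 epsL.
- by rewrite epsL muL.2.
rewrite (epsE nx) (epsE ky) (epsE (mu_deg nx ky)) (lmapZ (muL.1 _)) (lmapZ (muL.2 _)).
by rewrite scalerA kozD.
Qed.

Let d_mu x y : d (mu x y) = mu (d x) y + mu (eps x) (d y).
Proof.
move: x; apply: (linear_eq_on_dsum ddeg) => [a x z|a x z|n x nx].
- by rewrite muL.1 dL.
- by rewrite dL epsL !muL.1 scalerDr addrACA.
- by rewrite (leib _ nx) (epsE nx) (lmapZ (muL.1 _)).
Qed.

(** The data of the bar construction: [t] is the parity of the degree lowered by one, and the sign
    in [b] turns the Leibniz rule and associativity into the relations [db] and [bb]. *)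
Let H x := - h x.
Let t x := - eps x.
Let b x y := mu (eps x) y.

Let HL : linearP H. Proof. by move=> a x y; rewrite /H hL opprD scalerN. Qed.
Let tL : linearP t. Proof. by move=> a x y; rewrite /t epsL opprD scalerN. Qed.
Let bL : bilinearP b.
Proof. by split=> [y a x z|x a y z]; rewrite /b ?epsL ?muL.1 ?muL.2. Qed.

Let db x y : d (b x y) = - (b (d x) y + b (t x) (d y)).
Proof.
rewrite /b /t d_mu eps_d eps_K (lmapN epsL) eps_K.
by rewrite !(lmapN (muL.1 _)) -opprD opprK; congr (_ + _); rewrite -[d (eps x)]opprK -eps_d.
Qed.

Let bb x y z : b (b x y) z + b (t x) (b y z) = 0.
Proof.
by rewrite /b /t eps_mu (lmapN epsL) eps_K muA (lmapN (muL.1 _)) subrr.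
Qed.

Let tb x y : t (b x y) = - b (t x) (t y).
Proof.
by rewrite /b /t eps_mu (lmapN epsL) (lmapN (muL.1 _)) (lmapN (muL.2 _)) opprK.
Qed.

Let tH x : t (H x) = - H (t x).
Proof. by rewrite /t /H (lmapN epsL) (lmapN hL) eps_h !opprK. Qed.

Definition transfer_F := bar_F H b.
Definition transfer_B := bar_B d H b.
Definition transfer_f xs := transfer_F (twist eps 0 xs).
Definition transfer_nu xs := transfer_B (twist eps 0 xs).

Let Gi (pn : int * int) := G pn.1 pn.2.

Let G_retract p n x : G p n x -> G p n (retract d H x).
Proof.
move=> Gx; apply: subspaceD => //; first apply: subspaceD => //.
  rewrite /H (lmapN dL); apply: subspaceN => //.
  by rewrite -[n](subrK 1); exact/dG/hG.
by apply: subspaceN => //; rewrite -[n](addrK 1); exact/hG/dG.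
Qed.

Let G_prod F : (forall xs js, homog (0, 0) Gi xs js ->
      G (sumz (map fst js)) (sumz (map snd js) + 1 - (size xs)%:Z) (F xs)) ->
  forall xs js, homog (0, 0) Gi xs js ->
    G (sumz (map fst js)) (sumz (map snd js) + 2 - (size xs)%:Z) (bar_prod b F xs).
Proof.
move=> FG xs js hxs; apply: subspace_split_sum => // u v uvE.
rewrite -uvE in hxs *; have [iu [iv [-> /FG Gu /FG Gv]]] := homog_cat_inv hxs.
rewrite /b (epsE (Gdeg Gu)) (lmapZ (muL.1 _)); apply: subspaceZ => //.
apply: index_cast (muG Gu Gv); first by rewrite map_cat sumz_cat.
by rewrite map_cat sumz_cat size_cat; lia.
Qed.

Let G_single xs js : homog (0, 0) Gi xs js -> (size xs = 1)%N ->
  G (sumz (map fst js)) (sumz (map snd js)) (single xs).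
Proof.
case: xs js => [|x [|? ?]] // [|i [|? ?]] //; try by case.
by move=> /homog_cons[Gx _] _ /=; rewrite !sumz_cons !sumz_nil !addr0.
Qed.

(** A word of [s] letters undergoes [s - 1] products and [s - 1] homotopies. All of them respect the
    filtration, and each homotopy lowers the degree by one. *)
Lemma transfer_F_filtered xs js : homog (0, 0) Gi xs js ->
  G (sumz (map fst js)) (sumz (map snd js) + 1 - (size xs)%:Z) (transfer_F xs).
Proof.
rewrite /transfer_F /bar_F; move: {2}(size xs) => k; elim: k xs js => [|k IH] xs js hxs.
  exact: (subspace0 (sG _ _)).
apply: subspaceD => //.
  case: xs hxs => [|x [|? ?]] hxs; try exact: (subspace0 (sG _ _)).
  by apply: index_cast (G_single hxs _) => //=; lia.
apply: subspaceN => //; apply: index_cast (hG (G_prod IH hxs)) => //; lia.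
Qed.

Lemma transfer_B_filtered xs js : homog (0, 0) Gi xs js ->
  G (sumz (map fst js)) (sumz (map snd js) + 2 - (size xs)%:Z) (transfer_B xs).
Proof.
move=> hxs; apply: subspaceD => //; last first.
  by apply: G_retract; apply: G_prod hxs; exact: transfer_F_filtered.
case: xs hxs => [|x [|? ?]] hxs; try by rewrite /= lmap0 //; exact: (subspace0 (sG _ _)).
by apply: index_cast (dG (G_single hxs _)) => //=; lia.
Qed.

Let homog_degrees xs js : homog (0, 0) Gi xs js -> homog 0 deg xs (map snd js).
Proof.
elim: xs js => [|x xs IH] [|j js]; try by case.
by move=> /homog_cons[/Gdeg dx /IH]; rewrite /= => hxs; apply/homog_cons.
Qed.

(** Exhaustiveness gives each entry a filtration level, so degree statements follow from filtered
    ones. *)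
Let homog_lift xs ds : homog 0 deg xs ds ->
  exists2 js, homog (0, 0) Gi xs js & map snd js = ds.
Proof.
elim: xs ds => [|x xs IH] [|n ds]; try by case.
  by exists [::]; first exact/homog_nil.
move=> /homog_cons[/Gex[p Gx] /IH[js hxs <-]].
by exists ((p, n) :: js); first exact/homog_cons.
Qed.

Let transfer_B_deg xs ds : homog 0 deg xs ds -> (0 < size xs)%N ->
  deg (sumz ds + 2 - (size xs)%:Z) (transfer_B xs).
Proof. by move=> /homog_lift[js /transfer_B_filtered/Gdeg + <-]. Qed.

Let FL : multilinear transfer_F. Proof. exact: bar_F_multilinear. Qed.
Let BL : multilinear transfer_B. Proof. exact: bar_B_multilinear. Qed.

Lemma transfer_f_multilinear : multilinear transfer_f.
Proof. exact: twist_multilinear. Qed.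

Lemma transfer_nu_multilinear : multilinear transfer_nu.
Proof. exact: twist_multilinear. Qed.

Let transfer_twist (g : seq A -> A) xs ds : multilinear g -> homog 0 deg xs ds ->
  g (twist eps 0 xs) = koz K (kap ds) *: g xs.
Proof.
move=> gL hxs; have := multilinear_twist epsL epsE 0 [::] [::] gL hxs.
by rewrite /= !cats0 mul0r addr0.
Qed.

Lemma transfer_f_filtered xs js : homog (0, 0) Gi xs js ->
  G (sumz (map fst js)) (sumz (map snd js) + 1 - (size xs)%:Z) (transfer_f xs).
Proof.
move=> hxs; rewrite /transfer_f (transfer_twist FL (homog_degrees hxs)).
by apply: subspaceZ => //; exact: transfer_F_filtered.
Qed.

Lemma transfer_nu_filtered xs js : homog (0, 0) Gi xs js ->
  G (sumz (map fst js)) (sumz (map snd js) + 2 - (size xs)%:Z) (transfer_nu xs).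
Proof.
move=> hxs; rewrite /transfer_nu (transfer_twist BL (homog_degrees hxs)).
by apply: subspaceZ => //; exact: transfer_B_filtered.
Qed.

Lemma transfer_f_deg xs ds : homog 0 deg xs ds ->
  deg (sumz ds + 1 - (size xs)%:Z) (transfer_f xs).
Proof. by move=> /homog_lift[js /transfer_f_filtered/Gdeg + <-]. Qed.

Lemma transfer_nu_deg xs ds : homog 0 deg xs ds ->
  deg (sumz ds + 2 - (size xs)%:Z) (transfer_nu xs).
Proof. by move=> /homog_lift[js /transfer_nu_filtered/Gdeg + <-]. Qed.

Lemma transfer_f1 x : transfer_f [:: x] = x.
Proof. exact: bar_F1. Qed.

Lemma transfer_nu1 x : transfer_nu [:: x] = d x.
Proof. exact: bar_B1. Qed.

Lemma transfer_nu_nil : transfer_nu [::] = 0.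
Proof. exact: bar_B_nil. Qed.

(** Higher operations take values in the image of [1 - d h - h d], hence will restrict to the
    model. *)
Lemma transfer_nu_retract xs : (1 < size xs)%N ->
  exists y, transfer_nu xs = y - d (h y) - h (d y).
Proof.
move=> xs1; exists (bar_L H b (twist eps 0 xs)).
rewrite /transfer_nu /transfer_B /bar_B /retract /H (lmapN dL).
have -> : single (twist eps 0 xs) = 0 by case: xs xs1 => [|x [|y xs]].
by rewrite (lmap0 dL) add0r.
Qed.

Lemma transfer_stasheff xs ds : homog 0 deg xs ds ->
  ins_sum transfer_nu transfer_nu xs ds = 0.
Proof.
move=> hxs; rewrite (ins_sum_twist epsL epsE sdeg BL BL _ transfer_B_deg hxs) //;
  last exact: bar_B_nil.
rewrite -[split_sum _ _]/(insert_B d H t b (bar_B d H b) xs).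
by rewrite (insert_B_B dL HL tL bL dd db bb tb tH) scaler0.
Qed.

Lemma transfer_morphism xs ds : homog 0 deg xs ds ->
  ins_sum transfer_f transfer_nu xs ds = d (transfer_f xs) +
    \sum_(1 <= i < size xs)
      (kozn K (i - 1) * koz K ((1 - (size xs - i)%:Z) * sumz (take i ds)))
        *: mu (transfer_f (take i xs)) (transfer_f (drop i xs)).
Proof.
move=> hxs; rewrite (ins_sum_twist epsL epsE sdeg FL BL _ transfer_B_deg hxs) //;
  last exact: bar_B_nil.
rewrite -[split_sum _ _]/(insert_B d H t b (bar_F H b) xs).
rewrite (insert_B_F dL HL tL bL db bb tb tH).
rewrite scalerDr /transfer_f (transfer_twist FL hxs) (lmapZ dL); congr (_ + _).
rewrite /bar_L /bar_prod split_sum_index scaler_sumr.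
have b0l y : b 0 y = 0 by exact: (lmap0 (bL.1 y)).
have b0r y : b y 0 = 0 by exact: (lmap0 (bL.2 y)).
rewrite -(big_mkord xpredT (fun i => koz K (kap ds) *:
  b (bar_F H b (take i xs)) (bar_F H b (drop i xs)))).
have [xs0|xs0] := posnP (size xs).
  by rewrite xs0 big_nat1 big_geq // take0 b0l scaler0.
(* The cuts at both ends vanish since [bar_F] kills the empty word; the remaining range is
   [1 <= i < size xs]. *)
rewrite big_ltn // big_nat_recr //= take0 drop_size b0l b0r scaler0 addr0 add0r.
apply: eq_big_nat => i /andP[i0 ixs].
have [hu hv] := homog_split i hxs.
rewrite (transfer_twist FL hu) (transfer_twist FL hv) (lmapZ (muL.1 _)) (lmapZ (muL.2 _)).
have [js Gu jsE] := homog_lift hu.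
have := epsE (Gdeg (transfer_F_filtered Gu)); rewrite jsE /b => ->.
rewrite (lmapZ (muL.1 _)) !scalerA koznE -!kozD; congr (_ *: _).
have su : size (take i xs) = i by rewrite size_take_min; lia.
have sv : size (drop i ds) = (size xs - i)%N by rewrite size_drop -(homog_size hxs).
rewrite su -{1}(cat_take_drop i ds) kap_cat sv.
have -> : (i - 1)%N%:Z = i%:Z - 1 by lia.
(* The [eps] in [b] contributes the degree [sumz (take i ds) + 1 - i] of the left factor. Together
   with [kap_cat] this gives the stated exponent up to an even number. *)
apply: (@koz_cong K _ _ ((size xs - i)%N%:Z * sumz (take i ds) - i%:Z + 1)); ring.
Qed.

End TransferredStructure.

(** * A subspace as a module of its own *)

Section SubspaceType.
Variables (K : fieldType) (V : lmodType K) (S : V -> Prop) (hS : subspace S).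

Definition subspace_pred of subspace S : {pred V} := fun x => `[< S x >].

Fact subspace_pred_closed : submod_closed (subspace_pred hS).
Proof.
split; first by apply/asboolP; case: hS.
by move=> a x y /asboolP Sx /asboolP Sy; apply/asboolP; exact: hS.2.
Qed.

HB.instance Definition _ :=
  GRing.isSubmodClosed.Build K V (subspace_pred hS) subspace_pred_closed.

Record subspace_type := SubspaceType {
  subspace_val : V; _ : subspace_val \in subspace_pred hS }.

HB.instance Definition _ := [isSub for subspace_val].
HB.instance Definition _ := [Choice of subspace_type by <:].
HB.instance Definition _ := [SubChoice_isSubLmodule of subspace_type by <:].

End SubspaceType.

Lemma subspace_lmodType (K : fieldType) (V : lmodType K) (S : V -> Prop) : subspace S ->
  exists (M : lmodType K) (i : M -> V), [/\ linearP i, injective i,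
    forall m, S (i m) & forall x, S x -> exists m, i m = x].
Proof.
move=> hS; exists (subspace_type hS), (@subspace_val _ _ _ hS); split.
- by [].
- exact: val_inj.
- by case=> x /= /asboolP.
- by move=> x /asboolP Sx; exists (SubspaceType (Sx : x \in subspace_pred hS)).
Qed.

(** * Reduction to filtration-preserving homotopies *)
Section Decalage.
Variables (K : fieldType) (A : lmodType K) (r : nat).
Variables (degA : int -> A -> Prop) (FA : int -> int -> A -> Prop).
Variables (dA : A -> A) (mu : A -> A -> A).

Definition decalage (p n : int) : A -> Prop := Zr FA dA r%:Z (p + r%:Z * n) n.

(** The shift [p + r n] is additive in both indices, so products are respected, by Leibniz also for
    the condition on [d]. For [x] in [G p n], the condition on [d x] is exactly the index required
    in degree [n + 1]. *)
Lemma decalage_filtered_dga :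
  is_filtered_dga degA FA dA mu -> is_filtered_dga degA decalage dA mu.
Proof.
move=> fA; have fF := filtered_dga_filtration fA.
have [dga [hF [Fdeg [Fdec [dF [muF [Fex Fbd]]]]]]] := fA.
have [ddeg [dL [d_deg [dd [muL [mu_deg [muA leib]]]]]]] := dga.
split=> //; split.
  by move=> p n; apply: subspaceI => //; exact: subspace_preimage.
split; first by move=> p n x [/Fdeg].
split.
  move=> p n x [Fx Fdx]; split; [apply: (filtration_le fF) Fx|apply: (filtration_le fF) Fdx]; lia.
split.
  move=> p n x [Fx Fdx]; split; last by rewrite dd; exact: subspace0.
  by apply: (filtration_le fF) Fdx; lia.
split.
  move=> p q n k x y [Fx Fdx] [Fy Fdy].
  split; first by apply: index_cast (muF _ _ _ _ _ _ Fx Fy); lia.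
  rewrite (leib _ _ _ (Fdeg _ _ _ Fx)); apply: subspaceD => //.
    by apply: index_cast (muF _ _ _ _ _ _ Fdx Fy); lia.
  apply: subspaceZ => //.
  by apply: index_cast (muF _ _ _ _ _ _ Fx Fdy); lia.
split.
  move=> n x nx; have [p Fx] := Fex _ _ nx; have [q Fdx] := Fex _ _ (d_deg _ _ nx).
  exists (Num.min p (q - r%:Z) - r%:Z * n); split.
    by apply: (filtration_le fF) Fx; lia.
  by apply: (filtration_le fF) Fdx; lia.
move=> n; have [p Fp] := Fbd n; exists (p - r%:Z * n) => x [+ _].
by rewrite subrK; exact: Fp.
Qed.

End Decalage.

(** * The minimal model *)
Section Model.
Variables (K : fieldType) (A : lmodType K) (r : nat).
Variables (degA : int -> A -> Prop) (FA : int -> int -> A -> Prop).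
Variables (dA : A -> A) (mu : A -> A -> A).
Hypothesis fA : is_filtered_dga degA FA dA mu.

Let R := r%:Z.
Let G := decalage r FA dA.
Let fG : is_filtered_dga degA G dA mu. Proof. exact: decalage_filtered_dga. Qed.

Variables h eps : A -> A.
Hypothesis epsL : linearP eps.
Hypothesis epsE : forall n x, degA n x -> eps x = koz K n *: x.
Hypothesis hL : linearP h.
Hypothesis hG : forall p n x, G p n x -> G p (n - 1) (h x).
Hypothesis hh : forall x, h (h x) = 0.
Hypothesis hdh : forall x, h (dA (h x)) = h x.
Hypothesis hmin : forall p n x, G p n x -> G (p + 1) (n + 1) (dA x - dA (h (dA x))).

Variables (M : lmodType K) (i : M -> A) (j : A -> M).
Hypothesis iL : linearP i.
Hypothesis i_inj : injective i.
Hypothesis hi : forall m, h (i m) = 0.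
Hypothesis hdi : forall m, h (dA (i m)) = 0.
Hypothesis ij : forall x, h x = 0 -> h (dA x) = 0 -> i (j x) = x.

Let ddeg : dsum degA. Proof. by case: fA => -[]. Qed.
Let dL : linearP dA. Proof. by case: fA => -[_ []]. Qed.
Let dd x : dA (dA x) = 0. Proof. by case: fA => -[_ [_ [_ [+ _]]]] _; exact. Qed.
Let sF p n : subspace (FA p n). Proof. by case: fA => _ []. Qed.
Let F_le p q n x : p <= q -> FA q n x -> FA p n x.
Proof. exact: (filtration_le (filtered_dga_filtration fA)). Qed.
Let sG p n : subspace (G p n). Proof. by case: fG => _ []. Qed.
Let Gdeg p n x : G p n x -> degA n x. Proof. by case: fG => _ [_ [+ _]]; exact. Qed.
Let dG p n x : G p n x -> G p (n + 1) (dA x).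
Proof. by case: fG => _ [_ [_ [_ [+ _]]]]; exact. Qed.
Let Gex n x : degA n x -> exists p, G p n x.
Proof. by case: fG => _ [_ [_ [_ [_ [_ [+ _]]]]]]; exact. Qed.

Let rho x := x - dA (h x) - h (dA x).

Let rhoL : linearP rho.
Proof.
move=> a x y; rewrite /rho !(dL, hL) !scalerBr !opprD.
by rewrite [(a *: x + y) + _]addrACA [LHS]addrACA.
Qed.

Let h_rho x : h (rho x) = 0.
Proof. by rewrite /rho !(lmapB hL) hdh hh subrr sub0r oppr0. Qed.

Let d_rho x : dA (rho x) = rho (dA x).
Proof. by rewrite /rho !(lmapB dL) !dd (lmap0 hL) !subr0. Qed.

Let hd_rho x : h (dA (rho x)) = 0. Proof. by rewrite d_rho h_rho. Qed.

Let rho_i m : rho (i m) = i m.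
Proof. by rewrite /rho hi hdi (lmap0 dL) !subr0. Qed.

Let i_rho x : i (j (rho x)) = rho x. Proof. exact: ij. Qed.

Let rhoG p n x : G p n x -> G p n (rho x).
Proof.
move=> Gx; apply: subspaceB => //; first apply: subspaceB => //.
  by rewrite -[n](subrK 1); exact/dG/hG.
by rewrite -[n](addrK 1); exact/hG/dG.
Qed.

Let rho_deg n x : degA n x -> degA n (rho x).
Proof. by move=> /Gex[p /rhoG/Gdeg]. Qed.

Definition model_nu (xs : seq M) : M := j (transfer_nu dA mu eps h (map i xs)).
Definition model_f (xs : seq M) : A := transfer_f mu eps h (map i xs).

(** Since [j] inverts [i] only where [h] and [h d] vanish, both conditions are checked by arity: the
    value is [0] for the empty list, [d (i m)] for one entry, and in the image of [rho] beyond
    that. *)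
Lemma i_model_nu xs : i (model_nu xs) = transfer_nu dA mu eps h (map i xs).
Proof.
apply: ij; case: xs => [|x [|y xs]].
- by rewrite (transfer_nu_nil fG) // lmap0.
- by rewrite (transfer_nu1 fG) // hdi.
- have [//|z ->] := @transfer_nu_retract _ _ _ _ _ _ eps h fG (map i [:: x, y & xs]).
  exact: h_rho.
- by rewrite (transfer_nu_nil fG) // (lmap0 dL) lmap0.
- by rewrite (transfer_nu1 fG) // dd lmap0.
- have [//|z ->] := @transfer_nu_retract _ _ _ _ _ _ eps h fG (map i [:: x, y & xs]).
  exact: hd_rho.
Qed.

Lemma i_model_nu1 m : i (model_nu [:: m]) = dA (i m).
Proof. by rewrite i_model_nu (transfer_nu1 fG). Qed.

Lemma model_f1 m : model_f [:: m] = i m.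
Proof. exact: (transfer_f1 fG). Qed.

Definition model_deg n m := degA n (i m).
(** The regrading is undone here, so the model carries the filtration by [Z_r] of [FA], in the
    original indices. *)
Definition model_filt p n m := G (p - R * n) n (i m).

Lemma model_filtP p n m :
  model_filt p n m <-> FA p n (i m) /\ FA (p + R) (n + 1) (dA (i m)).
Proof. by rewrite /model_filt /G /decalage /Zr subrK. Qed.

(** As [h d] vanishes on the model, [hmin] says that [d] gains one step of [G], which is [r + 1]
    steps once the degree shift is undone. *)
Lemma model_filt_d p n m : model_filt p n m -> model_filt (p + R + 1) (n + 1) (model_nu [:: m]).
Proof.
rewrite /model_filt i_model_nu1 => /hmin; rewrite hdi (lmap0 dL) subr0.
by have -> : p - R * n + 1 = p + R + 1 - R * (n + 1) by ring.
Qed.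

Lemma model_deg_dsum : dsum model_deg.
Proof.
have [_ [degspan degfree]] := ddeg.
split; first by move=> n; apply: subspace_preimage => //; case: ddeg.
split.
  move=> m; have [s [g [_ [dg imE]]]] := degspan (i m).
  exists s, (fun n => j (rho (g n))); split=> //; split.
    by move=> n; rewrite /model_deg i_rho; exact: rho_deg.
  apply: i_inj; rewrite (lmap_sum iL) -rho_i imE (lmap_sum rhoL).
  by apply: eq_bigr => n _; rewrite i_rho.
move=> s g us dg gs0 n sn; apply: i_inj; rewrite (lmap0 iL).
by apply: (degfree s (fun n => i (g n))) => //; rewrite -(lmap_sum iL) gs0 (lmap0 iL).
Qed.

Lemma model_filtration : filtration model_deg model_filt.
Proof.
have [_ _ _ Gdec [_ Gbd]] := filtered_dga_filtration fG.
split; first exact: model_deg_dsum.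
- by move=> p n; exact: subspace_preimage.
- by move=> p n m /Gdeg.
- by move=> p n m; rewrite /model_filt addrAC; exact: Gdec.
- split=> n; last first.
    have [p Gp] := Gbd n; exists (p + R * n) => m; rewrite /model_filt addrK => /Gp m0.
    by apply: i_inj; rewrite m0 lmap0.
  by move=> m /Gex[p Gm]; exists (p + R * n); rewrite /model_filt addrK.
Qed.

(** By [model_filt_d] the differential [d_r] of the model is zero. Injectivity therefore amounts to
    moving [m] into step [p + 1]; surjectivity is achieved by applying [rho] to a corrected
    cocycle. *)
Lemma model_quasi_iso : Er_quasi_iso model_filt (fun m => model_nu [:: m])
  FA dA (fun m => model_f [:: m]) R.
Proof.
have filt_d0 p n m : model_filt p n (model_nu [:: model_nu [:: m]]).
  suff -> : model_nu [:: model_nu [:: m]] = 0 by rewrite /model_filt (lmap0 iL); exact: subspace0.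
  by apply: i_inj; rewrite !i_model_nu1 dd (lmap0 iL).
have filt0 p n : model_filt p n 0 by rewrite /model_filt (lmap0 iL); exact: subspace0.
have nu10 : model_nu [:: 0] = 0 by apply: i_inj; rewrite i_model_nu1 (lmap0 iL) (lmap0 dL).
have filt_le p q n m : p <= q -> model_filt q n m -> model_filt p n m.
  exact: (filtration_le model_filtration).
move=> p n; split.
  move=> m [[Fm Fdm] _] [y [[Fy Fdy] [u [z [[Fu Fdu] [[Fz Fdz] mE]]]]]].
  rewrite model_f1 in mE.
  (* Here [i m = d (y + z) + u]. Applying [rho] fixes [i m], keeps [u] in the next step, and sends
     [d (y + z)] to [d (rho (y + z))], which gains a step by [hmin]. *)
  have Fm1 : model_filt (p + 1) n m.
    have Gw : G (p - R * n) (n - 1) (y + z).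
      split; last rewrite (lmapD dL); apply: subspaceD => //.
      - by apply: index_cast Fy; ring.
      - by apply: F_le Fz; lia.
      - by apply: index_cast Fdy; ring.
      - by apply: index_cast Fdz; ring.
    have uE : u = i m - dA (y + z) by rewrite (lmapD dL) opprD addrA mE addrK.
    have Gu : G (p - R * n + 1) n u.
      split; first by apply: index_cast Fu; rewrite -/R; ring.
      rewrite uE (lmapB dL) dd subr0 -i_model_nu1.
      have /model_filtP[+ _] := model_filt_d Fm.
      by apply: index_cast; rewrite -/R; ring.
    rewrite /model_filt -rho_i.
    have -> : i m = dA (y + z) + u by rewrite uE addrC subrK.
    have -> : p + 1 - R * n = p - R * n + 1 by ring.
    rewrite (lmapD rhoL); apply: subspaceD => //; last exact: rhoG.
    have := hmin (rhoG Gw).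
    by rewrite -d_rho hd_rho (lmap0 dL) subr0 subrK.
  exists 0; split.
    by split; rewrite ?nu10; exact: filt0.
  rewrite nu10 subr0; exists m, 0; rewrite nu10 addr0; split;
    last by split=> //; split; rewrite ?nu10; exact: filt0.
  split=> //; apply: filt_le (model_filt_d Fm1); lia.
move=> a [[Fa Fda] [u [z [[Fu Fdu] [[Fz Fdz] daE]]]]].
(* Subtracting [z] keeps the class of [a] in [E_r] and moves its differential into step
   [p + r + 1]. *)
have uE : dA (a - z) = u by rewrite (lmapB dL) daE addrK.
have Gu : G (p + 1 - R * n) (n + 1) u.
  split; first by apply: index_cast Fu; rewrite -/R; ring.
  by rewrite -uE dd; exact: subspace0.
have Gaz : G (p - R * n) n (a - z).
  split; last by rewrite uE; apply: F_le Fu; lia.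
  rewrite subrK; apply: subspaceB => //; apply: F_le (@index_cast _ _ FA _ _ _ n _ erefl _ Fz); lia.
exists (j (rho (a - z))); split.
  have Fx : model_filt p n (j (rho (a - z))) by rewrite /model_filt i_rho; exact: rhoG.
  have Fdx := model_filt_d Fx.
  split; first by split=> //; apply: filt_le Fdx; lia.
  exists (model_nu [:: j (rho (a - z))]), 0; split.
    by split; [exact: Fdx|exact: filt_d0].
  by split; [split; rewrite ?nu10; exact: filt0|rewrite nu10 addr0].
exists (h (a - z)); split.
  have [F1 F2] := hG Gaz; split; [apply: index_cast F1|apply: index_cast F2]; rewrite -/R; ring.
rewrite model_f1 i_rho.
have [F1 F2] := hG Gu.
(* With [c = a - z], expanding [rho c] gives [a - rho c - d (h c) = z + h (d c)], where
   [d c = u]. *)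
exists (z + h u), 0; split; last first.
  split; first by split; rewrite ?(lmap0 dL); exact: subspace0.
  rewrite (lmap0 dL) addr0 -uE /rho.
  rewrite -{1}(subrK z a); move: (a - z) => c.
  by rewrite !opprB [c + z]addrC addrACA [c + _]addrC subrK addrK.
split; first apply: subspaceD => //.
- by apply: index_cast Fz; ring.
- by apply: index_cast F1; rewrite -/R; ring.
rewrite (lmapD dL); apply: subspaceD => //.
  by apply: F_le (@index_cast _ _ FA _ _ _ (n + 1) _ erefl _ Fdz); lia.
by apply: F_le (@index_cast _ _ FA _ _ _ (n + 1) _ erefl _ F2); rewrite -/R; lia.
Qed.

(** * Bidegrees on the model *)

Section Bigraded.
Variable Mb : int -> int -> M -> Prop.
Hypothesis dMb : dsum (fun pq : int * int => Mb pq.1 pq.2).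
Hypothesis Mb_filt : forall p q m, Mb p q m -> model_filt p (p + q) m.
Hypothesis filtE : forall p n m, model_filt p n m <-> bifilt Mb p n m.
Hypothesis degE : forall n m, model_deg n m <-> bideg Mb n m.

Lemma homog_map_i xs ds : homog 0 model_deg xs ds -> homog 0 degA (map i xs) ds.
Proof.
elim: xs ds => [|x xs IH] [|n ds]; try by case.
by move=> /homog_cons[dx /IH hxs]; apply/homog_cons.
Qed.

(** Bidegree [(p, q)] becomes degree [p + q] and index [p - R * (p + q)] for [G]; both are linear,
    so they add up over a list. *)
Lemma homog_bigraded xs pqs : homog (0, 0) (fun pq : int * int => Mb pq.1 pq.2) xs pqs ->
  exists2 js, homog (0, 0) (fun pn : int * int => G pn.1 pn.2) (map i xs) js &
    sumz (map snd js) = sumz (map fst pqs) + sumz (map snd pqs) /\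
    sumz (map fst js) = sumz (map fst pqs) - R * sumz (map snd js).
Proof.
elim: xs pqs => [|x xs IH] [|[p q] pqs]; try by case.
  by exists [::]; [exact/homog_nil|rewrite /= !sumz_nil mulr0 subrr].
move=> /homog_cons[/Mb_filt Gx /IH[js hjs [nE pE]]].
exists ((p - R * (p + q), p + q) :: js); first exact/homog_cons.
by rewrite /= !sumz_cons pE nE; split; ring.
Qed.

Lemma map_insert u x w : map i (u ++ x :: w) = map i u ++ i x :: map i w.
Proof. by rewrite map_cat. Qed.

Lemma model_nu_multilinear : multilinear model_nu.
Proof.
move=> l1 l2 a x y; apply: i_inj; rewrite iL !i_model_nu !map_insert iL.
exact: (transfer_nu_multilinear fG).
Qed.

Lemma model_f_multilinear : multilinear model_f.
Proof.
move=> l1 l2 a x y; rewrite /model_f !map_insert iL.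
exact: (transfer_f_multilinear fG).
Qed.

Lemma model_minimal : Er_minimal_model r degA FA dA mu Mb model_nu model_f.
Proof.
have bidegE : bideg Mb = model_deg.
  by apply: funext => n; apply: funext => m; apply: propext; split=> /degE.
have bifiltE : bifilt Mb = model_filt.
  by apply: funext => p; apply: funext => n; apply: funext => m; apply: propext; split=> /filtE.
have insE xs ds : i (ins_sum model_nu model_nu xs ds) =
    ins_sum (transfer_nu dA mu eps h) (transfer_nu dA mu eps h) (map i xs) ds.
  rewrite /ins_sum size_map (lmap_sum iL); apply: eq_bigr => k _.
  rewrite (lmap_sum iL); apply: eq_bigr => s _.
  by rewrite (lmapZ iL) i_model_nu map_insert i_model_nu !map_take !map_drop.
have insfE xs ds : ins_sum model_f model_nu xs ds =
    ins_sum (transfer_f mu eps h) (transfer_nu dA mu eps h) (map i xs) ds.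
  rewrite /ins_sum size_map; apply: eq_bigr => k _; apply: eq_bigr => s _.
  by rewrite /model_f map_insert i_model_nu !map_take !map_drop.
rewrite /Er_minimal_model bidegE bifiltE; split=> //; split.
  split; first exact: model_deg_dsum.
  split; first exact: model_nu_multilinear.
  split=> xs ds /homog_map_i hxs _.
    rewrite /model_deg i_model_nu -(size_map i).
    exact: (transfer_nu_deg fG).
  apply: i_inj; rewrite insE (lmap0 iL).
  exact: (transfer_stasheff fG).
split.
  move=> p q m /Mb_filt/model_filt_d/filtE.
  apply: sum_of_equiv => -[p' q'] /= [nE pp'].
  by exists (p' - (p + R + 1)); split; [lia|congr (_, _); lia].
split.
  move=> xs pqs /homog_bigraded[js hjs [nE pE]] _ /=.
  have := transfer_nu_filtered fG epsL epsE hL hG hjs.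
  rewrite -i_model_nu size_map pE nE => Gnu.
  set s := (size xs)%:Z in Gnu *; set P := sumz (map fst pqs) in Gnu *.
  set Q := sumz (map snd pqs) in Gnu *.
  (* The output has degree [P + Q + 2 - s], so undoing the regrading turns the index
     [P - R * (P + Q)] into [P + (2 - s) * R]. *)
  have /filtE : model_filt (P + (2 - s) * R) (P + Q + 2 - s) (model_nu xs).
    by apply: index_cast Gnu; ring.
  apply: sum_of_equiv => -[p' q'] /= [n'E pp'].
  exists (p' - (P + (2 - s) * R)); split; first by lia.
  by congr (_, _); first ring; lia.
split.
  split; first exact: model_f_multilinear.
  split=> xs ds /homog_map_i hxs _.
    by rewrite -(size_map i); exact: (transfer_f_deg fG).
  rewrite insfE (transfer_morphism fG epsL epsE hL hG hxs) size_map.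
  by congr (_ + _); apply: eq_bigr => k _; rewrite /model_f map_take map_drop.
split; last exact: model_quasi_iso.
move=> xs pqs /homog_bigraded[js hjs [nE pE]] _ /=.
(* Only membership in [FA] is kept from [Z_r]; the degree [1 - s] of [f_s] accounts for the shift
   [(1 - s) * R]. *)
have [+ _] := transfer_f_filtered fG epsL epsE hL hG hjs.
by rewrite size_map pE nE -/R; apply: index_cast; ring.
Qed.

End Bigraded.

End Model.

Theorem theorem3p16 (K : fieldType) (r : nat) (A : lmodType K)
    (degA : int -> A -> Prop) (FA : int -> int -> A -> Prop)
    (dA : A -> A) (mu : A -> A -> A) :
  is_filtered_dga degA FA dA mu ->
  exists (M : lmodType K) (Mb : int -> int -> M -> Prop)
         (nu : seq M -> M) (f : seq M -> A),
    Er_minimal_model r degA FA dA mu Mb nu f.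
Proof.
move=> fA; have fG := decalage_filtered_dga r fA.
have [[ddeg [dL [_ [dd _]]]] [_ [_ [_ [dG _]]]]] := fG.
have [eps [epsL epsE]] := exists_parity ddeg.
have [h [hL hG hh hdh hmin]] :=
  filtered_contraction (filtered_dga_filtration fG) dL dG dd.
have [|M [i [iL i_inj iS Si]]] :=
    @subspace_lmodType _ _ (fun x => h x = 0 /\ h (dA x) = 0).
  apply: subspaceI; first exact: subspace_kernel.
  by apply: subspace_kernel => a x y; rewrite dL hL.
(* [j] is a set-theoretic inverse of [i] on its image, with default value [0] elsewhere. *)
have [|j jP] := @choice _ _ (fun x m => h x = 0 -> h (dA x) = 0 -> i m = x).
  move=> x; have [[hx hdx]|nx] := pselect (h x = 0 /\ h (dA x) = 0); last first.
    by exists 0 => hx hdx; case: nx.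
  by have [m <-] := Si x (conj hx hdx); exists m.
have hi m : h (i m) = 0 by case: (iS m).
have hdi m : h (dA (i m)) = 0 by case: (iS m).
have [Mb [dMb MbF filtE degE]] := exists_bigrading
  (model_filtration fA hL hG hh hdh iL i_inj hi hdi jP).
exists M, Mb, (model_nu dA mu h eps i j), (model_f mu h eps i).
exact: (model_minimal fA epsL epsE hL hG hh hdh hmin iL i_inj hi hdi jP).
Qed.
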